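(* Draw the triangular lattice with one family of lattice lines horizontal. Let $H$ be a hexagonal lattice region all of whose six sides have positive length, symmetric about a vertical line $\ell$. Let $\mathcal C$ be a collection of unit triangles of $H$ that is symmetric about $\ell$ and contains no unit triangle touching the southern or the southeastern side of $H$. Let $R_0=H\setminus\mathcal C$, and let $R$ be the region obtained from $H$ by removing the translates of the triangles of $\mathcal C$ by one unit lattice segment in the southeast lattice direction. Let $\ell'$ be the translate of $\ell$ by half a unit to the right, and let $R^+,R^-,\widehat R^+,\widehat R^-$ be the weighted regions defined in the context. Assume $R_0$ has at least one lozenge tiling. Then $$\operatorname{M}(R)=2^{\operatorname{w}_{\ell'}(R)-1}\left(\operatorname{M}(R^+)\operatorname{M}(R^-)+\operatorname{M}(\widehat{R}^+)\operatorname{M}(\widehat{R}^-)\right),$$ where $\operatorname{w}_{\ell'}(R)$ is half the number of unit triangles of $R$ crossed by $\ell'$.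
   Context: A lozenge is the union of two unit triangles sharing an edge. For a region $Q$ on the triangular lattice in which lozenge positions may carry weights, $\operatorname{M}(Q)$ denotes the sum over all lozenge tilings of $Q$ of the product of the weights of the lozenges used (the number of lozenge tilings if all weights are $1$). Equivalently, let the dual graph of $Q$ have the unit triangles of $Q$ as vertices, two being adjacent when they share an edge (weight of the edge = weight of the corresponding lozenge); it is bipartite (up- versus down-pointing triangles), and $\operatorname{M}(Q)$ is its weighted number of perfect matchings. Construction of $R^\pm$ and $\widehat R^\pm$: let $G$ be the dual graph of $R$. The line $\ell'$ passes through lattice points, and the unit triangles of $R$ crossed by $\ell'$ (each bisected by it) are the vertices of $G$ on $\ell'$; list them from top to bottom as $a_1,b_1,a_2,b_2,\dots$. Color the two classes of $G$ white and black so that $a_1$ is white. At every white $a_i$ and every black $b_i$ delete the edges of $G$ joining it to triangles lying on one fixed side of $\ell'$ (say the right side), and at every black $a_i$ and every white $b_i$ delete the edges joining it to triangles on the other (left) side. Give weight $1/2$ to every edge joining two triangles both crossed by $\ell'$, all other weights being $1$. The resulting graph splits into a part consisting of the triangles strictly to the right of $\ell'$ together with the triangles on $\ell'$ whose edges to the left were deleted, and a part consisting of the triangles strictly to the left of $\ell'$ together with the triangles on $\ell'$ whose edges to the right were deleted; $R^+$ and $R^-$ are the corresponding weighted regions. The regions $\widehat R^+$ and $\widehat R^-$ are defined in the same way, but with the coloring chosen so that $a_1$ is black (equivalently, at each triangle on $\ell'$ the deletion is performed on the side opposite to the one used for $R^\pm$). *)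

(* Defs.v *)
(* Plain MathComp with finmap; weights and tiling sums are in rat. *)
From HB Require Import structures.
From mathcomp Require Export all_boot all_order all_algebra.
From mathcomp Require Export finmap.
Set Implicit Arguments.
Unset Strict Implicit.
Unset Printing Implicit Defensive.
Import Order.TTheory GRing.Theory Num.Theory.
Local Open Scope fset_scope.
Local Open Scope ring_scope.

Record wgraph (K : choiceType) := WGraph {
  vtx : {fset K};
  edges : {fset {fset K}};
  weight : {fset K} -> rat }.

Definition edges_of (K : choiceType) (Q : {fset K}) (e : rel K) :
    {fset {fset K}} :=
  [fset [fset t; u] | t in Q, u in Q & e t u].

Definition induced (K : choiceType) (G : wgraph K) (S : {fset K}) : wgraph K :=
  WGraph S [fset B in edges G | B `<=` S] (weight G).

Definition covers_once (K : choiceType) (Q : {fset K}) (P : {fset {fset K}}) :=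
  all (fun t => #|` [fset B in P | t \in B]| == 1%N) Q.

Definition perfect_matching (K : choiceType) (G : wgraph K)
    (P : {fset {fset K}}) : bool :=
  (P `<=` edges G) && covers_once (vtx G) P.

Definition M (K : choiceType) (G : wgraph K) : rat :=
  \sum_(P <- fpowerset (edges G) | perfect_matching G P)
    \prod_(B <- P) weight G B.

(* Points are written (x, y), with x measured in half units and y in units of
   sqrt 3 / 2, so that the lattice points are the pairs with x + y even. *)
Definition point : Type := (int * int)%type.

Definition lattice_point (p : point) : bool := (2 %| p.1 + p.2)%Z.

(* In the horizontal strip s <= y <= s + 1 every vertical line x = k with k an
   integer is the axis of symmetry of exactly one unit triangle: (k, s) stands
   for that triangle. *)
Definition tri : Type := (int * int)%type.

Definition up (t : tri) : bool := ~~ (2 %| t.1 + t.2)%Z.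

Definition corners (t : tri) : seq point :=
  let: (k, s) := t in
  if up t then [:: (k - 1, s); (k + 1, s); (k, s + 1)]
  else [:: (k - 1, s + 1); (k + 1, s + 1); (k, s)].

(* Two unit triangles share an edge iff they have exactly two corners in
   common. *)
Definition adjacent (t u : tri) : bool :=
  count (mem (corners u)) (corners t) == 2%N.

Definition dual_graph (Q : {fset tri}) : wgraph (int * int)%type :=
  WGraph Q (edges_of Q adjacent) (fun=> 1).

Definition vE  : point := (2, 0).
Definition vSE : point := (1, -1).
Definition vSW : point := (-1, -1).
Definition vW  : point := (-2, 0).
Definition vNW : point := (-1, 1).
Definition vNE : point := (1, 1).

Definition shiftSE (t : tri) : tri := (t.1 + vSE.1, t.2 + vSE.2).

(* The northwestern corner followed by the side lengths, clockwise from the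
   northern side. *)
Record hexagon := Hexagon {
  hNW : point;
  sideN : nat; sideNE : nat; sideSE : nat;
  sideS : nat; sideSW : nat; sideNW : nat }.

Definition lattice_hexagon (h : hexagon) : Prop :=
  [/\ lattice_point (hNW h),
      [&& 0 < sideN h, 0 < sideNE h, 0 < sideSE h,
          0 < sideS h, 0 < sideSW h & 0 < sideNW h]%N
    & vE *+ sideN h + vSE *+ sideNE h + vSW *+ sideSE h
      + vW *+ sideS h + vNW *+ sideSW h + vNE *+ sideNW h = 0].

Definition hNE (h : hexagon) : point := hNW h + vE *+ sideN h.
Definition hE  (h : hexagon) : point := hNE h + vSE *+ sideNE h.
Definition hSE (h : hexagon) : point := hE h + vSW *+ sideSE h.
Definition hSW (h : hexagon) : point := hSE h + vW *+ sideS h.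
Definition hW  (h : hexagon) : point := hSW h + vNW *+ sideSW h.

(* x + y is constant on lines parallel to the NE and SW sides, x - y on lines
   parallel to the SE and NW sides. *)
Definition in_hexagon (h : hexagon) (p : point) : bool :=
  [&& (hSE h).2 <= p.2 <= (hNW h).2,
      (hW h).1 + (hW h).2 <= p.1 + p.2 <= (hE h).1 + (hE h).2
    & (hW h).1 - (hW h).2 <= p.1 - p.2 <= (hE h).1 - (hE h).2].

Definition is_region_of (h : hexagon) (H : {fset tri}) : Prop :=
  forall t : tri, (t \in H) = all (in_hexagon h) (corners t).

Definition on_S_side (h : hexagon) (p : point) : bool :=
  in_hexagon h p && (p.2 == (hSE h).2).
Definition on_SE_side (h : hexagon) (p : point) : bool :=
  in_hexagon h p && (p.1 - p.2 == (hE h).1 - (hE h).2).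

(* Touching includes touching in a single point; a unit triangle contained in
   the hexagon meets a side iff one of its corners lies on that side. *)
Definition touches_S (h : hexagon) (t : tri) : bool :=
  has (on_S_side h) (corners t).
Definition touches_SE (h : hexagon) (t : tri) : bool :=
  has (on_SE_side h) (corners t).

(* Below, an integer m stands for the vertical line x = m. *)

Definition mirror (m : int) (t : tri) : tri := (2 * m - t.1, t.2).

Definition symmetric_about (m : int) (A : {fset tri}) : Prop :=
  [fset mirror m t | t in A] = A.

(* The triangle (k, s) spans k - 1 <= x <= k + 1, so the line x = m meets its
   interior iff k = m, and then bisects it. *)
Definition crossed (m : int) (t : tri) : bool := t.1 == m.
Definition right_of (m : int) (t : tri) : bool := m < t.1.
Definition left_of (m : int) (t : tri) : bool := t.1 < m.

Section Cut.
Variables (m : int) (Q : {fset tri}).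

(* The list a_1, b_1, a_2, b_2, ..., from top to bottom. *)
Definition crossed_list : seq tri :=
  sort (fun t u : tri => u.2 <= t.2) [seq t <- enum_fset Q | crossed m t].

Definition width : nat := (size crossed_list)./2.

(* a_white says whether a_1 is white: true for R+ and R-, false for their
   hatted versions. *)
Variable a_white : bool.

Definition is_a (t : tri) : bool := ~~ odd (index t crossed_list).

(* The default value of head is only used when the line crosses no triangle,
   in which case the colors play no role. *)
Definition white (t : tri) : bool :=
  (up t == up (head (0, 0) crossed_list)) == a_white.

(* For t crossed by the line: t is a white a_i or a black b_i. *)
Definition cut_on_right (t : tri) : bool :=
  (white t && is_a t) || (~~ white t && ~~ is_a t).

Definition deleted_at (t u : tri) : bool :=
  crossed m t && (if cut_on_right t then right_of m u else left_of m u).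

Definition cut_adjacent (t u : tri) : bool :=
  [&& adjacent t u, ~~ deleted_at t u & ~~ deleted_at u t].

Definition cut_weight (B : {fset tri}) : rat :=
  if all (crossed m) (enum_fset B) then 2^-1 else 1.

Definition cut_graph : wgraph (int * int)%type :=
  WGraph Q (edges_of Q cut_adjacent) cut_weight.

Definition plus_part : wgraph (int * int)%type :=
  induced cut_graph
    [fset t in Q | right_of m t || (crossed m t && ~~ cut_on_right t)].

Definition minus_part : wgraph (int * int)%type :=
  induced cut_graph
    [fset t in Q | left_of m t || (crossed m t && cut_on_right t)].

End Cut.

(* Main.v *)
Require Import Defs.
From mathcomp Require Import all_boot all_order all_algebra all_fingroup finmap.
From mathcomp Require Import zify ring.
Import Order.TTheory GRing.Theory Num.Theory.
Set Implicit Arguments.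
Unset Strict Implicit.
Unset Printing Implicit Defensive.

(** The reflection in l' maps R to itself, except for the strip formed by the
    two leftmost triangles of every row of H, whose mirror images lie outside
    H.  Let q be this reflection, extended by the identity on the strip, and let
    m be the involution of a perfect matching.  The orbits of <m, q> through
    the fixed points of q (the triangles on l' and those of the strip) are
    paths with exactly two such fixed points, and replacing m by q m q along a
    path with both ends on l' gives another matching of R.

    Attach to each triangle x on l', matched off l', the sum mod 2 of its
    orientation, the number of triangles of R above it on l', and the side of
    l' on which it is matched.  Since the paths do not cross, the two ends of a
    path on l' carry the same bit, and an end of a path leading from l' to the
    strip carries the bit 1.  The matchings of the cut graphs are exactly those
    with a constant bit.  At most one upper and at most one lower triangle of
    the strip is matched out of the strip, so that there are 0 or 2 paths from
    l' to the strip.  In the first case a class of matchings modulo flips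
    contains one matching with constant bit 0 and one with constant bit 1, in
    the second case only the latter; the number of flips is half as large in
    the second case, so in both cases the count is the asserted one. *)

(** * Parity of a finite set carrying an involution *)

(** Two-element orbits [{x, f x}] are removed one at a time; each removal changes the cardinality by
    2 and leaves the fixed points alone. *)
Lemma odd_card_involution (V : finType) (A : {set V}) (f : V -> V) :
    {in A, forall x, f x \in A} -> {in A, forall x, f (f x) = x} ->
  odd #|A| = odd #|[set x in A | f x == x]|.
Proof.
have [n] := ubnP #|A|; elim: n A => // n IHn A leAn fA fK.
have [/eqP E | ] := boolP ([set x in A | f x != x] == set0).
  congr (odd _); apply: eq_card => x; rewrite !inE.
  by case: (boolP (x \in A)) => //= xA; move/setP/(_ x): E; rewrite !inE xA /= => /negbFE.
case/set0Pn=> x; rewrite inE => /andP[xA fx].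
have fxA := fA x xA.
pose B := A :\: [set x; f x].
have card2 : #|[set x; f x]| = 2%N by rewrite cards2 eq_sym fx.
have sub2 : [set x; f x] \subset A by rewrite subUset !sub1set xA fxA.
have cA : #|A| = (#|B| + 2)%N.
  by rewrite -(cardsID [set x; f x] A) (setIidPr sub2) card2 addnC.
have fB : {in B, forall y, f y \in B}.
  move=> y; rewrite !inE !negb_or => /andP[/andP[yx yfx] yA]; rewrite fA // andbT.
  apply/andP; split; first by apply: contraNneq yfx => <-; rewrite fK.
  by apply: contraNneq yx => E; rewrite -(fK y yA) E fK.
rewrite cA oddD addbF IHn //; last 2 first.
- by move: leAn; rewrite cA; lia.
- by move=> y; rewrite inE => /andP[_ yA]; apply: fK.
congr (odd _); apply: eq_card => y; rewrite !inE.
case: (altP (f y =P y)) => E; rewrite ?andbF // !andbT.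
case: (boolP (y \in A)) => yA; rewrite ?andbF //= negb_or andbT.
apply/andP; split; first by apply: contraNneq fx => <-; rewrite E.
by apply: contraNneq fx => yE; rewrite -{2}(fK x xA) -yE E.
Qed.

Lemma even_card_involution (V : finType) (A : {set V}) (f : V -> V) :
    {in A, forall x, f x \in A} -> {in A, forall x, f (f x) = x} ->
    {in A, forall x, f x != x} ->
  ~~ odd #|A|.
Proof.
move=> fA fK fN; rewrite (odd_card_involution fA fK).
have -> : [set x in A | f x == x] = set0; last by rewrite cards0.
by apply/setP => x; rewrite !inE; case: (boolP (x \in A)) => // /fN /negbTE.
Qed.

(** * The orbit of a fixed point under a product of two involutions *)

Definition walk (V : finType) (q m : {perm V}) : {perm V} := (m * q)%g.

(* If q fixes x and r is the size of its orbit under p := walk q m, then q acts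
   on that orbit by p^i x |-> p^-i x and m by p^i x |-> p^(-i-1) x.  As m has no
   fixed point, r is even, and q fixes exactly x and p^(r/2) x. *)
Definition partner (V : finType) (q m : {perm V}) (x : V) : V :=
  ((walk q m) ^+ (#|porbit (walk q m) x|./2))%g x.

Section Partner.

Variables (V : finType) (q m : {perm V}).
Hypothesis qK : forall v, q (q v) = v.
Hypothesis mK : forall v, m (m v) = v.
Hypothesis mN : forall v, m v != v.

Local Notation p := (walk q m).

Lemma walkE v : p v = q (m v). Proof. by rewrite permM. Qed.

Lemma walkVE v : (p^-1)%g v = m (q v).
Proof. by apply: (canLR (permK p)); rewrite walkE mK qK. Qed.

Lemma porbit_walk x y : y \in porbit p x -> p y \in porbit p x.
Proof. by case/porbitP=> i ->; rewrite -permM -expgSr mem_porbit. Qed.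

Lemma porbit_walkV x y : y \in porbit p x -> (p^-1)%g y \in porbit p x.
Proof. by rewrite -(porbitV p x) => /porbitP[i ->]; rewrite -permM -expgSr mem_porbit. Qed.

(** Forward steps suffice: an orbit of a permutation of a finite set consists of nonnegative powers
    applied to [x]. *)
Lemma porbit_ind x (P : V -> Prop) :
    P x -> (forall v, v \in porbit p x -> P v -> P (p v)) ->
  forall y, y \in porbit p x -> P y.
Proof.
move=> Px Pp y /porbitP[i ->]; elim: i => [|i IH]; first by rewrite expg0 perm1.
by rewrite expgSr permM; apply: Pp; rewrite ?mem_porbit.
Qed.

Variable x : V.
Hypothesis qx : q x = x.

Let r := #|porbit p x|.

Let r_gt0 : (0 < r)%N. Proof. by rewrite lt0n card_porbit_neq0. Qed.

Let pr : (p ^+ r)%g x = x. Proof. by rewrite permX iter_porbit. Qed.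

Let pe i j : ((p ^+ i)%g x == (p ^+ j)%g x) = (i == j %[mod r]).
Proof.
have red k : (p ^+ k)%g x = (p ^+ (k %% r))%g x.
  rewrite {1}(divn_eq k r) expgD permM; congr ((p ^+ _)%g _).
  elim: (k %/ r) => [|n IH]; first by rewrite mul0n expg0 perm1.
  by rewrite mulSn expgD permM pr.
have small k : (k < r)%N -> (p ^+ k)%g x = nth x (traject p x r) k.
  by move=> lt; rewrite nth_traject // permX.
rewrite (red i) (red j) !small ?ltn_mod //.
by rewrite nth_uniq ?size_traject ?ltn_mod // uniq_traject_porbit.
Qed.

Let qp i j : (i + j = 0 %[mod r])%N -> q ((p ^+ i)%g x) = (p ^+ j)%g x.
Proof.
move=> E; apply: (@perm_inj _ (p ^+ i)%g).
(* As [p q p = q], each factor [p] on the left of [q] cancels one on the right, down to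
   [q x = x]. *)
have -> : (p ^+ i)%g (q ((p ^+ i)%g x)) = x.
  elim: i {E} => [|i IH]; first by rewrite !expg0 !perm1.
  have -> : (p ^+ i.+1)%g x = p ((p ^+ i)%g x) by rewrite expgSr permM.
  by rewrite walkE qK expgS permM walkE mK.
by rewrite -permM -expgD; apply/eqP; rewrite eq_sym -[X in _ == X](perm1 x) -(expg0 p) pe addnC E.
Qed.

(** If r = 2h + 1, then [q] sends [p^(h+1) x] to [p^h x]; but it also sends it to [m (p^h x)], so
    [m] would have a fixed point. *)
Let r_even : ~~ odd r.
Proof.
apply/negP => r_odd; pose h := r./2.
have rE : r = h.*2.+1 by rewrite -[LHS]odd_double_half r_odd.
have: q ((p ^+ h.+1)%g x) = (p ^+ h)%g x.
  by apply: qp; rewrite addSn addnn -rE modnn mod0n.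
by rewrite expgSr permM walkE qK => E; move: (mN ((p ^+ h)%g x)); rewrite E eqxx.
Qed.

Let rE : r = (r./2).*2. Proof. by rewrite -[LHS]odd_double_half (negbTE r_even). Qed.

Lemma partner_porbit : partner q m x \in porbit p x. Proof. exact: mem_porbit. Qed.

Lemma partner_fix : q (partner q m x) = partner q m x.
Proof. by apply: qp; rewrite addnn -rE modnn mod0n. Qed.

Lemma partner_neq : partner q m x != x.
Proof.
rewrite -[X in _ != X](perm1 x) -(expg0 p) pe mod0n modn_small; last by lia.
by lia.
Qed.

Let fixed_exponent i : (i < r)%N -> q ((p ^+ i)%g x) = (p ^+ i)%g x ->
  i = 0%N \/ i = r./2.
Proof.
move=> lt_ir.
rewrite (qp (j := r - i)); last by rewrite subnKC ?modnn ?mod0n // ltnW.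
move/eqP; rewrite pe => /eqP; case: i lt_ir => [|i] lt_ir; first by left.
by rewrite !modn_small; try lia; move=> E; right; lia.
Qed.

Let porbit_lt y : y \in porbit p x -> exists2 i, i < r & y = (p ^+ i)%g x.
Proof. by rewrite porbit_traject => /trajectP[i lt ->]; exists i; rewrite ?permX. Qed.

Lemma partner_uniq y : y \in porbit p x -> q y = y -> y = x \/ y = partner q m x.
Proof.
case/porbit_lt => i lt_ir -> /(fixed_exponent lt_ir) [] ->; last by right.
by left; rewrite expg0 perm1.
Qed.

Lemma porbit_q y : y \in porbit p x -> q y \in porbit p x.
Proof.
by case/porbit_lt=> i lt ->; rewrite (qp (j := r - i)) ?mem_porbit ?subnKC ?modnn ?mod0n // ltnW.
Qed.

Lemma porbit_m y : y \in porbit p x -> m y \in porbit p x.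
Proof. by move=> yp; rewrite -[m y]qK -walkE porbit_q ?porbit_walk. Qed.

(** Transports an invariant from [x] to its partner. The step is required only where [q] moves
    [m v], because the walk meets no fixed point of [q] strictly between the two ends. *)
Lemma partner_walk (P : V -> Prop) :
    P x -> (forall v, P v -> q (m v) != m v -> P (q (m v))) ->
  exists2 v, P v & partner q m x = m v.
Proof.
move=> Px Pp; have [h hE] : exists h, r./2 = h.+1 by exists (r./2).-1; lia.
have all i : (i <= h)%N -> P ((p ^+ i)%g x).
  elim: i => [|i IH] lt; first by rewrite expg0 perm1.
  rewrite expgSr permM walkE; apply: Pp; first by apply: IH; lia.
  apply/negP => /eqP E; have: q ((p ^+ i.+1)%g x) = (p ^+ i.+1)%g x.
    by rewrite expgSr permM walkE qK.
  by case/fixed_exponent; lia.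
exists ((p ^+ h)%g x); first exact: all.
have := partner_fix; rewrite /partner -/r hE expgSr permM walkE qK => E.
by rewrite -E.
Qed.

End Partner.

Section PartnerInvolution.

Variables (V : finType) (q m : {perm V}).
Hypothesis qK : forall v, q (q v) = v.
Hypothesis mK : forall v, m (m v) = v.
Hypothesis mN : forall v, m v != v.

Lemma porbit_partner x : porbit (walk q m) (partner q m x) = porbit (walk q m) x.
Proof. exact: porbit_perm. Qed.

Lemma partnerK x : q x = x -> partner q m (partner q m x) = x.
Proof.
move=> qx; have qy := partner_fix qK mK mN qx.
have: x \in porbit (walk q m) (partner q m x) by rewrite porbit_partner porbit_id.
case/(partner_uniq qK mK mN qy) => // E.
by have := partner_neq qK mK mN qx; rewrite -E eqxx.
Qed.

Lemma partner_fixed_edge x : q x = x -> q (m x) = m x -> partner q m x = m x.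
Proof.
move=> qx qmx; case: (partner_uniq qK mK mN qx (y := m x)) => //.
  by apply: porbit_m => //; apply: porbit_id.
by move=> E; have := mN x; rewrite E eqxx.
Qed.

End PartnerInvolution.

(** * Flipping a matching along a stable set *)

(* Restricting q to a set T stable under m and q, this is q m q on T and m off T. *)
Definition flip (V : finType) (q : {perm V}) (T : {set V}) (m : {perm V}) :
  {perm V} := (m ^ restr_perm T q)%g.

Section Flip.

Variables (V : finType) (q : {perm V}) (T : {set V}).
Hypothesis qK : forall v, q (q v) = v.
Hypothesis qT : forall v, (q v \in T) = (v \in T).

Let restrE v : restr_perm T q v = if v \in T then q v else v.
Proof.
case: ifPn => vT; last by rewrite (out_perm (restr_perm_on _ _)).
by rewrite restr_permE //; apply/astabsP => x; rewrite /= apermE qT.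
Qed.

Lemma flipE (m : {perm V}) v : (forall v, (m v \in T) = (v \in T)) ->
  flip q T m v = if v \in T then q (m (q v)) else m v.
Proof.
move=> mT; rewrite /flip.
have gK u : restr_perm T q (restr_perm T q u) = u.
  by rewrite !restrE; case: (boolP (u \in T)) => uT; rewrite ?qT ?uT ?qK ?(negbTE uT).
rewrite -{1}(gK v) permJ !restrE; case: (boolP (v \in T)) => vT.
  by rewrite mT qT vT.
by rewrite mT (negbTE vT).
Qed.

Variable m : {perm V}.
Hypothesis mT : forall v, (m v \in T) = (v \in T).

Lemma flip_stable v : (flip q T m v \in T) = (v \in T).
Proof. by rewrite flipE //; case: (boolP (v \in T)) => vT; rewrite ?qT mT ?qT // (negbTE vT). Qed.

Lemma flipK : flip q T (flip q T m) = m.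
Proof.
apply/permP => v; rewrite (flipE _ flip_stable) !flipE //.
by case: (boolP (v \in T)) => vT; rewrite ?qT ?vT ?qK.
Qed.

Hypothesis mK : forall v, m (m v) = v.

(** On [T] the new walk is [q (q m q) = m q], the inverse of the old one, and off [T] it is the old
    one; neither leaves an orbit. *)
Lemma porbit_flip_sub x : porbit (walk q (flip q T m)) x \subset porbit (walk q m) x.
Proof.
apply/subsetP; apply: porbit_ind => [|v _ vp]; first exact: porbit_id.
rewrite walkE flipE //; case: ifP => _; last by rewrite -walkE; apply: porbit_walk.
by rewrite qK -walkVE // porbit_walkV.
Qed.

End Flip.

(** The reverse inclusion is the same one applied to the flipped matching, since flipping twice
    gives [m] back. *)
Lemma porbit_flip (V : finType) (q : {perm V}) (T : {set V}) (m : {perm V}) (x : V) :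
    (forall v, q (q v) = v) -> (forall v, (q v \in T) = (v \in T)) ->
    (forall v, m (m v) = v) -> (forall v, (m v \in T) = (v \in T)) ->
  porbit (walk q (flip q T m)) x = porbit (walk q m) x.
Proof.
move=> qK qT mK mT; apply/eqP; rewrite eqEsubset porbit_flip_sub //=.
rewrite -{1}(flipK qK qT mT); apply: porbit_flip_sub => //; first exact: flip_stable.
move=> v; rewrite !flipE // ?qT ?mT.
by case: (boolP (v \in T)) => vT; rewrite ?qT ?mT ?qT ?vT ?qK ?mK ?qK // (negbTE vT).
Qed.

(** * Counting matchings modulo flips *)

Section FlipCount.

Variables (V : finType) (q : {perm V}) (L S : {set V}) (side tau0 : V -> bool).
Variable Ms : {set {perm V}}.

(* In the application, [side] tells the side of l' on which x is matched and
   [tau0] collects the contributions to the bit of x that do not depend on m. *)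
Definition tau (m : {perm V}) (x : V) := tau0 x (+) side (m x).
Definition constant_tau (c : bool) (m : {perm V}) :=
  [forall x in L, (m x \notin L) ==> (tau m x == c)].
Definition inner (m : {perm V}) := [set x in L | m x \in L].

Hypothesis qK : forall v, q (q v) = v.
Hypothesis q_fix : forall v, (q v == v) = (v \in L) || (v \in S).
Hypothesis LS : forall v, v \in L -> v \notin S.
Hypothesis side_q : forall v, v \notin L -> v \notin S -> side (q v) = ~~ side v.
Hypothesis MsK : forall m v, m \in Ms -> m (m v) = v.
Hypothesis MsN : forall m v, m \in Ms -> m v != v.
Hypothesis Ms_flip : forall m (T : {set V}), m \in Ms -> (forall v, (q v \in T) = (v \in T)) ->
  (forall v, (m v \in T) = (v \in T)) -> (forall v, v \in T -> v \notin S) ->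
  flip q T m \in Ms.
Hypothesis tau_partner : forall m x, m \in Ms -> x \in L -> m x \notin L ->
  partner q m x \in L -> tau m (partner q m x) = tau m x.
Hypothesis tau_escape : forall m x, m \in Ms -> x \in L ->
  partner q m x \in S -> tau m x.
Hypothesis card_escape : forall m, m \in Ms ->
  let n := #|[set x in L | partner q m x \in S]| in (n == 0) || (n == 2).

Let qL v : (q v \in L) = (v \in L).
Proof.
have aux u : u \in L -> q u \in L.
  by move=> uL; have /eqP -> : q u == u by rewrite q_fix uL.
by apply/idP/idP => /aux; rewrite ?qK.
Qed.

Let fixL x : x \in L -> q x = x.
Proof. by move=> xL; apply/eqP; rewrite q_fix xL. Qed.

(* The invariant of a class of matchings modulo flips: which points of L are
   joined, and which of them are matched inside L. *)
Let key (m : {perm V}) := ([ffun x => if x \in L then partner q m x else x], inner m).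

(** The set along which all paths starting in [A] are flipped at once. *)
Let tube (A : {set V}) m := \bigcup_(x in A) porbit (walk q m) x.

Section OneMatching.

Variables (m : {perm V}) (A : {set V}).
Hypothesis mMs : m \in Ms.
Hypothesis AL : A \subset L.
Hypothesis Apartner : forall x, x \in A -> partner q m x \in L.

Let mK v : m (m v) = v. Proof. exact: MsK. Qed.
Let mN v : m v != v. Proof. exact: MsN. Qed.

Let Afix x : x \in A -> q x = x. Proof. by move/(subsetP AL)/fixL. Qed.

Let tube_q v : (q v \in tube A m) = (v \in tube A m).
Proof.
have aux u : u \in tube A m -> q u \in tube A m.
  case/bigcupP=> x xA ux; apply/bigcupP; exists x => //.
  by apply: porbit_q => //; apply: Afix.
by apply/idP/idP => /aux; rewrite ?qK.
Qed.

Let tube_m v : (m v \in tube A m) = (v \in tube A m).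
Proof.
have aux u : u \in tube A m -> m u \in tube A m.
  case/bigcupP=> x xA ux; apply/bigcupP; exists x => //.
  by apply: porbit_m => //; apply: Afix.
by apply/idP/idP => /aux; rewrite ?mK.
Qed.

(** The only fixed points of [q] on a path are its two ends, which here both lie in [L]. *)
Let tube_S v : v \in tube A m -> v \notin S.
Proof.
case/bigcupP=> x xA vx; apply/negP => vS.
have qv : q v = v by apply/eqP; rewrite q_fix vS orbT.
case: (partner_uniq qK mK mN (Afix xA) vx qv) => vE; move: vS; rewrite vE.
  by rewrite (negbTE (LS _)) // (subsetP AL).
by rewrite (negbTE (LS _)) // Apartner.
Qed.

Let m' := flip q (tube A m) m.

Let m'Ms : m' \in Ms. Proof. exact: Ms_flip. Qed.

Let porbit_m' x : porbit (walk q m') x = porbit (walk q m) x.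
Proof. exact: porbit_flip. Qed.

(** A flip preserves orbits, and the partner of [x] is the only other fixed point of [q] in the
    orbit of [x]. *)
Lemma partner_flip x : q x = x -> partner q m' x = partner q m x.
Proof.
move=> qx.
have m'K v : m' (m' v) = v by apply: MsK.
have m'N v : m' v != v by apply: MsN.
have yp : partner q m' x \in porbit (walk q m) x.
  by rewrite -porbit_m' partner_porbit.
case: (partner_uniq qK mK mN qx yp (partner_fix qK m'K m'N qx)) => // E.
by have := partner_neq qK m'K m'N qx; rewrite E eqxx.
Qed.

Lemma inner_flip : inner m' = inner m.
Proof.
apply/setP => x; rewrite !inE; case: (boolP (x \in L)) => //= xL.
by rewrite flipE // (fixL xL); case: ifP; rewrite ?qL.
Qed.

Lemma key_flip : key m' = key m.
Proof.
congr (_, _); last exact: inner_flip.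
by apply/ffunP => x; rewrite !ffunE; case: ifP => // xL; rewrite partner_flip ?fixL.
Qed.

(** On the tube the mate of [x] becomes [q (m x)], which lies on the other side. *)
Lemma tau_flip x : x \in L -> m x \notin L ->
  tau m' x = tau m x (+) (x \in tube A m).
Proof.
move=> xL mxL; rewrite /tau flipE // (fixL xL).
case: ifP => xT; rewrite ?addbF // side_q //; first by rewrite addbT addbN.
by apply: tube_S; rewrite tube_m.
Qed.

Lemma tube_flip : tube A m' = tube A m.
Proof. by apply: eq_bigr => x _; rewrite porbit_m'. Qed.

Lemma flip_tubeK : flip q (tube A m') m' = m.
Proof. by rewrite tube_flip flipK. Qed.

Lemma flip_Ms : m' \in Ms. Proof. exact: m'Ms. Qed.

Lemma mem_tube x : x \in L -> x \in tube A m ->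
  exists2 y, y \in A & x = y \/ x = partner q m y.
Proof.
move=> xL /bigcupP[y yA xy]; exists y => //.
exact: (partner_uniq qK mK mN (Afix yA) xy (fixL xL)).
Qed.

Lemma sub_tube x : x \in A -> x \in tube A m.
Proof. by move=> xA; apply/bigcupP; exists x => //; apply: porbit_id. Qed.

End OneMatching.

Section OneClass.

Variable m0 : {perm V}.
Hypothesis m0Ms : m0 \in Ms.

Let pi := partner q m0.
Let cls := [set m in Ms | key m == key m0].
Let esc := [set x in L | pi x \in S].
Let I := inner m0.
(** One end of each path that joins two points of [L] matched outside [L]; the rank only serves to
    select an end. *)
Let X := [set x in L :\: I | (pi x \in L) && (enum_rank x < enum_rank (pi x))].
Let N := #|[set m in cls | [set x in X | tau m x] == set0]|.

Let m0K v : m0 (m0 v) = v. Proof. exact: MsK. Qed.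
Let m0N v : m0 v != v. Proof. exact: MsN. Qed.

Let clsP m : m \in cls -> [/\ m \in Ms, forall x, x \in L -> partner q m x = pi x
                             & inner m = I].
Proof.
rewrite inE => /andP[mMs /eqP[/ffunP E EI]]; split=> // x xL.
by have := E x; rewrite !ffunE xL.
Qed.

Let cls_inner m x : m \in cls -> x \in L -> (m x \in L) = (x \in I).
Proof. by case/clsP=> _ _ <- xL; rewrite inE xL. Qed.

Let pi_LS x : x \in L -> (pi x \in L) = (pi x \notin S).
Proof.
move=> xL; apply/idP/idP; first exact: LS.
have := partner_fix qK m0K m0N (fixL xL); move/eqP; rewrite q_fix.
by case/orP => // ->.
Qed.

Let piK x : x \in L -> pi (pi x) = x.
Proof. by move=> xL; apply: partnerK => //; apply: fixL. Qed.

Let pi_neq x : x \in L -> pi x != x.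
Proof. by move=> xL; apply: partner_neq => //; apply: fixL. Qed.

Let pi_I x : x \in L -> pi x \in L -> (pi x \in I) = (x \in I).
Proof.
have aux y : y \in L -> y \in I -> pi y \in I.
  move=> yL; rewrite !inE yL /= => my.
  have E : pi y = m0 y by apply: partner_fixed_edge => //; apply: fixL.
  by rewrite E my m0K yL.
move=> xL pxL; apply/idP/idP; last exact: aux.
by move/(aux _ pxL); rewrite piK.
Qed.

Let esc_I x : x \in esc -> x \notin I.
Proof.
rewrite !inE => /andP[xL pS]; rewrite xL /=; apply/negP => mx.
move: pS; rewrite /pi partner_fixed_edge ?fixL // => mS.
by move: (LS mx); rewrite mS.
Qed.

Let X_L x : x \in X -> x \in L. Proof. by rewrite !inE => /andP[/andP[]]. Qed.
Let X_I x : x \in X -> x \notin I. Proof. by rewrite inE => /andP[]; rewrite inE => /andP[]. Qed.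
Let X_pi x : x \in X -> pi x \in L. Proof. by rewrite !inE => /andP[_ /andP[]]. Qed.
Let X_rank x : x \in X -> enum_rank x < enum_rank (pi x).
Proof. by rewrite inE => /andP[_ /andP[]]. Qed.

(** [X] contains only one end of each path, so the tube of [A] catches no further point of [X]. *)
Let X_tube m (A : {set V}) x : m \in cls -> A \subset X -> x \in X -> (x \in tube A m) = (x \in A).
Proof.
move=> mc AX xX; have [mMs mpi _] := clsP mc.
have AL : A \subset L by apply/subsetP => y /(subsetP AX)/X_L.
apply/idP/idP; last exact: sub_tube.
case/(mem_tube mMs AL (X_L xX)) => y yA [-> //|].
have yX := subsetP AX _ yA; rewrite mpi ?X_L // => E.
have := X_rank xX; rewrite E piK ?X_L // => l1; have l2 := X_rank yX.
by move: (ltn_trans l1 l2); rewrite ltnn.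
Qed.

Let flip_cls m (A : {set V}) (mc : m \in cls) (AX : A \subset X) :
  [/\ flip q (tube A m) m \in cls,
     flip q (tube A (flip q (tube A m) m)) (flip q (tube A m) m) = m
   & forall x, x \in X -> tau (flip q (tube A m) m) x = tau m x (+) (x \in A)].
Proof.
have [mMs mpi mI] := clsP mc.
have AL : A \subset L by apply/subsetP => y /(subsetP AX)/X_L.
have Ap x : x \in A -> partner q m x \in L.
  by move/(subsetP AX) => xX; rewrite mpi ?X_pi ?X_L.
split; last 1 first.
- move=> x xX; rewrite tau_flip ?(cls_inner mc) ?X_L ?X_I //.
  by rewrite X_tube.
- by move: mc; rewrite !inE flip_Ms //= key_flip // => /andP[].
- exact: flip_tubeK.
Qed.

(** Flipping the paths that start in [A] toggles the bits exactly on [A]. It therefore embeds the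
    fiber over [A] into the one over the empty set, and conversely. *)
Let card_fiber (A : {set V}) : A \subset X ->
  #|[set m in cls | [set x in X | tau m x] == A]| = N.
Proof.
move=> AX; pose f m := flip q (tube A m) m.
have f_inj B : {in [set m in cls | [set x in X | tau m x] == B] &, injective f}.
  move=> m1 m2; rewrite !inE => /andP[c1 _] /andP[c2 _] E.
  have m1c : m1 \in cls by rewrite inE.
  have m2c : m2 \in cls by rewrite inE.
  have [_ <- _] := flip_cls m1c AX; have [_ E2 _] := flip_cls m2c AX.
  by rewrite -[RHS]E2; rewrite /f in E; rewrite E.
apply/eqP; rewrite eqn_leq; apply/andP; split.
- rewrite -(card_in_imset (f_inj A)); apply/subset_leq_card/subsetP => _ /imsetP[m + ->].
  rewrite inE => /andP[mc /eqP mA]; have [fc _ ft] := flip_cls mc AX.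
  rewrite inE fc; apply/eqP/setP => x; rewrite in_set0 inE; apply/negP => /andP[xX].
  by rewrite ft //; move/setP/(_ x): mA; rewrite inE xX /= => ->; rewrite addbb.
- rewrite /N -(card_in_imset (f_inj set0)); apply/subset_leq_card/subsetP => _ /imsetP[m + ->].
  rewrite inE => /andP[mc /eqP mA]; have [fc _ ft] := flip_cls mc AX.
  rewrite inE fc; apply/eqP/setP => x; rewrite inE.
  case: (boolP (x \in X)) => xX; last first.
    by symmetry; apply/negP => /(subsetP AX); rewrite (negbTE xX).
  rewrite ft //; move/setP/(_ x): mA; rewrite inE xX inE /= => ->; done.
Qed.

Let card_cls : #|cls| = (2 ^ #|X| * N)%N.
Proof.
rewrite -sum1_card (partition_big (fun m => [set x in X | tau m x]) (mem (powerset X))) /=.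
  rewrite (eq_bigr (fun=> N)).
    by rewrite sum_nat_const card_powerset.
  move=> A; rewrite inE => AX; rewrite -(card_fiber AX) -sum1_card.
  by apply: eq_bigl => m; rewrite inE.
by move=> m _; rewrite inE; apply/subsetP => x; rewrite inE => /andP[].
Qed.

Let constant_tauP c m : m \in cls ->
  reflect (forall x, x \in L -> x \notin I -> tau m x = c) (constant_tau c m).
Proof.
move=> mc; apply: (iffP forall_inP) => [H x xL xI | H x xL].
  by apply/eqP; have := H x xL; rewrite (cls_inner mc xL) xI.
by apply/implyP; rewrite (cls_inner mc xL) => xI; apply/eqP/H.
Qed.

Let tau_pi m x : m \in cls -> x \in L -> x \notin I -> pi x \in L -> tau m (pi x) = tau m x.
Proof.
move=> mc xL xI px; have [mMs mpi mI] := clsP mc.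
by rewrite -mpi // tau_partner // ?mpi // (cls_inner mc).
Qed.

Let half x : x \in L -> x \notin I -> pi x \in L -> (x \in X) || (pi x \in X).
Proof.
move=> xL xI px; rewrite !inE xL px piK // xL /=.
have := pi_I xL px; rewrite !inE px xL /= => ->.
move: xI; rewrite inE xL /= => -> /=.
have := pi_neq xL; rewrite -(inj_eq enum_rank_inj) -(inj_eq val_inj) /= neq_ltn orbC.
by [].
Qed.

(** Escaping points have bit 1 in any case and partners have equal bits, so the bit is constantly 1
    as soon as it is 1 on [X]. *)
Let card_true : #|[set m in cls | constant_tau true m]| = N.
Proof.
rewrite -(card_fiber (subxx X)); apply: eq_card => m; rewrite !inE.
case: (boolP (_ \in Ms)) => //= mMs; case: (boolP (_ == key m0)) => //= mk.
have mc : m \in cls by rewrite inE mMs mk.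
apply/(constant_tauP _ mc)/eqP => [H | /setP H x xL xI].
  by apply/setP => x; rewrite inE; case: (boolP (x \in X)) => //= xX; rewrite H ?X_L ?X_I.
have HX y : y \in X -> tau m y by move=> yX; have := H y; rewrite inE yX.
have [pxL|] := boolP (pi x \in L); last first.
  rewrite pi_LS // negbK => pxS; apply: tau_escape => //.
  by have [_ -> ] := clsP mc.
by case/orP: (half xL xI pxL) => /HX // ; rewrite tau_pi.
Qed.

(** An escaping point has bit 1, which rules out the constant bit 0; without escaping points the
    bits on [X] decide. *)
Let card_false : #|[set m in cls | constant_tau false m]| = ((#|esc| == 0) * N)%N.
Proof.
have [e0 | /set0Pn[x xe]] := boolP (esc == set0); last first.
  have -> : (#|esc| == 0) = false by apply/negbTE; rewrite cards_eq0; apply/set0Pn; exists x.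
  apply/eqP; rewrite mul0n cards_eq0; apply/eqP/setP => m; rewrite inE in_set0.
  apply/negP => /andP[mc /(constant_tauP _ mc)/(_ x) H].
  have [mMs mpi _] := clsP mc.
  have xI := esc_I xe; move: xe; rewrite inE => /andP[xL xS].
  have := tau_escape mMs xL; rewrite H // mpi // xS.
  by move/(_ isT).
rewrite (eqP e0) cards0 eqxx mul1n; apply: eq_card => m; rewrite !inE.
case: (boolP (_ \in Ms)) => //= mMs; case: (boolP (_ == key m0)) => //= mk.
have mc : m \in cls by rewrite inE mMs mk.
apply/(constant_tauP _ mc)/eqP => [H | /setP H x xL xI].
  apply/setP => x; rewrite !in_set0 inE; apply/negP => /andP[xX].
  by rewrite H ?X_L ?X_I.
have HX y : y \in X -> tau m y = false.
  by move=> yX; have := H y; rewrite inE yX in_set0.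
have [pxL|] := boolP (pi x \in L); last first.
  by rewrite pi_LS // negbK => pxS; move/eqP/setP/(_ x): e0; rewrite !inE xL pxS.
by case/orP: (half xL xI pxL) => /HX // ; rewrite tau_pi.
Qed.

(** [L] consists of the points matched inside [L], both ends of the paths counted by [X], and the
    escaping points. The first set is even because [m0] pairs it up. *)
Let card_L : #|L| = ((#|I|./2).*2 + #|X|.*2 + #|esc|)%N.
Proof.
have evenI : ~~ odd #|I|.
  apply: (even_card_involution (f := m0)) => [x|x _|x _]; rewrite ?m0K // ?m0N //.
  by rewrite !inE m0K => /andP[-> ->].
have -> : (#|I|./2).*2 = #|I| by rewrite -[RHS]odd_double_half (negbTE evenI).
have IL : I \subset L by apply/subsetP => x; rewrite inE => /andP[].
rewrite -(cardsID I L) (setIidPr IL) -addnA; congr (_ + _)%N.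
have eL : esc \subset L :\: I.
  by apply/subsetP => x xe; rewrite inE esc_I //; move: xe; rewrite inE => /andP[].
rewrite -(cardsID esc (L :\: I)) (setIidPr eL) addnC; congr (_ + _)%N.
set F := _ :\: esc.
have FP x : (x \in F) = [&& x \in L, x \notin I & pi x \in L].
  rewrite !in_setD inE; case: (boolP (x \in L)) => xL; rewrite ?andbF //=.
  by rewrite pi_LS // andbT andbC.
rewrite -(cardsID X F) -addnn; congr (_ + _)%N.
  by apply: eq_card => x; rewrite in_setI FP; case: (boolP (x \in X)) => xX;
     rewrite ?andbF // X_L ?X_I ?X_pi.
have pi_inj : {in X &, injective pi}.
  by move=> x y /X_L xL /X_L yL E; rewrite -(piK xL) E piK.
rewrite -(card_in_imset pi_inj); apply: eq_card => x; rewrite in_setD FP.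
apply/andP/imsetP => [[xX /and3P[xL xI pxL]] | [y yX ->]].
  exists (pi x); last by rewrite piK.
  by have := half xL xI pxL; rewrite (negbTE xX).
have [yL yI yp] := And3 (X_L yX) (X_I yX) (X_pi yX).
rewrite yp pi_I // yI piK // yL; split => //.
apply/negP => /X_rank; rewrite piK // => l1; have l2 := X_rank yX.
by move: (ltn_trans l1 l2); rewrite ltnn.
Qed.

Local Open Scope ring_scope.

(** The class has [2 ^ #|X| * N] members. Without escaping points both constant bits contribute [N]
    and [#|L|./2] is [#|I|./2 + #|X|]; with two of them only the bit 1 contributes, and [#|L|./2] is
    larger by one, which makes up for the missing factor 2. *)
Lemma class_count : (#|cls|%:R : rat) = 2 ^ ((#|L|./2)%:Z - 1) *
  \sum_(m in cls) ((constant_tau true m)%:R + (constant_tau false m)%:R)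
     / 2 ^+ (#|inner m|./2).
Proof.
have -> : \sum_(m in cls) (((constant_tau true m)%:R + (constant_tau false m)%:R)
     / 2 ^+ (#|inner m|./2) : rat) =
   (#|[set m in cls | constant_tau true m]|
     + #|[set m in cls | constant_tau false m]|)%:R / 2 ^+ (#|I|./2).
  rewrite natrD -!sum1_card !natr_sum.
  under eq_bigl do rewrite inE.
  under [X in _ = (_ + X) / _]eq_bigl do rewrite inE.
  rewrite !big_mkcondr -big_split /= mulr_suml; apply: eq_bigr => m mc.
  have [_ _ ->] := clsP mc.
  by rewrite sum1_card; do 2 case: constant_tau.
rewrite card_cls card_true card_false.
have := card_escape m0Ms; rewrite -/pi -/esc /= => /orP[]/eqP E; move: card_L; rewrite E /= => cL.
  have -> : #|L|./2 = (#|I|./2 + #|X|)%N by rewrite cL; lia.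
  rewrite expfzDr // exprN1 -exprnP exprD mul1n addnn -mul2n !natrM !natrX.
  by field; rewrite expf_neq0.
have -> : #|L|./2 = (#|I|./2 + #|X|).+1%N by rewrite cL; lia.
rewrite expfzDr // exprN1 -exprnP exprS exprD mul0n addn0 natrM natrX.
by field; rewrite expf_neq0.
Qed.

End OneClass.

Local Open Scope ring_scope.

Lemma flip_count : (#|Ms|%:R : rat) = 2 ^ ((#|L|./2)%:Z - 1) *
  (\sum_(m in Ms | constant_tau true m) 2 ^- (#|inner m|./2)
   + \sum_(m in Ms | constant_tau false m) 2 ^- (#|inner m|./2)).
Proof.
rewrite !big_mkcondr -big_split /= -[#|Ms|]sum1_card natr_sum.
rewrite (partition_big key xpredT) //= [in RHS](partition_big key xpredT) //= mulr_sumr.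
apply: eq_bigr => k _.
case: (pickP [pred m in Ms | key m == k]) => [m0 /= /andP[m0Ms /eqP <-] | no]; last first.
  by rewrite !big_pred0 ?mulr0.
transitivity (#|[set m in Ms | key m == key m0]|%:R : rat).
  by rewrite -[#|_|]sum1_card natr_sum; apply: eq_bigl => m; rewrite inE.
rewrite class_count //; congr (_ * _); apply: eq_big => m; first by rewrite inE.
by move=> _; do 2 case: constant_tau; rewrite ?addr0 ?add0r ?mul1r ?mul0r ?mulrDl ?mul1r.
Qed.

End FlipCount.

Local Open Scope fset_scope.
Local Open Scope ring_scope.

(** * Perfect matchings as involutions of the vertex set *)

Section MatchingsAsInvolutions.

Variables (K : choiceType) (Q : {fset K}).

Definition matchings (e : rel K) : {set {perm Q}} :=
  [set m : {perm Q} | [forall v, e (val v) (val (m v)) && (m (m v) == v)]].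

Lemma matchingsP (e : rel K) (m : {perm Q}) :
  reflect ((forall v, e (val v) (val (m v))) /\ (forall v, m (m v) = v))
    (m \in matchings e).
Proof.
rewrite inE; apply: (iffP forallP) => [H | [H1 H2] v].
  by split=> v; case/andP: (H v) => // _ /eqP.
by rewrite H1 H2 eqxx.
Qed.

Definition pair_of (m : {perm Q}) (v : Q) : {fset K} := [fset val v; val (m v)].

Definition pairs_of (m : {perm Q}) : {fset {fset K}} :=
  [fset pair_of m v | v in {: Q}].

(* The 2-coloring [col] serves to choose one endpoint of every edge. *)
Variables (e : rel K) (w : {fset K} -> rat) (col : pred K).
Hypothesis e_sym : symmetric e.
Hypothesis e_col : forall t u, e t u -> col u = ~~ col t.

Let G := WGraph Q (edges_of Q e) w.

Lemma fset2_eq (T : choiceType) (a b c d : T) :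
  [fset a; b] = [fset c; d] -> (a = c /\ b = d) \/ (a = d /\ b = c).
Proof.
move=> E.
have: a \in [fset c; d] by rewrite -E fset21.
have: b \in [fset c; d] by rewrite -E fset22.
have: c \in [fset a; b] by rewrite E fset21.
have: d \in [fset a; b] by rewrite E fset22.
rewrite !in_fset2; do 4 (case/orP => /eqP ?); subst; auto.
Qed.

Lemma pair_of_sym m v : m \in matchings e -> pair_of m (m v) = pair_of m v.
Proof. by case/matchingsP=> _ mK; rewrite /pair_of mK fsetUC. Qed.

Lemma pair_of_mem m u v : m \in matchings e -> val v \in pair_of m u ->
  pair_of m u = pair_of m v.
Proof.
move=> mM; rewrite in_fset2 => /orP[] /eqP /val_inj -> //.
by rewrite pair_of_sym.
Qed.

Lemma pairs_ofP m B :
  reflect (exists v, B = pair_of m v) (B \in pairs_of m).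
Proof.
apply: (iffP (imfsetP _ _ _ _)) => [[v _ ->] | [v ->]]; first by exists v.
by exists v.
Qed.

Lemma pairs_of_pm m : m \in matchings e -> perfect_matching G (pairs_of m).
Proof.
move=> mM; have /matchingsP[me mK] := mM.
apply/andP; split.
  apply/fsubsetP => B /pairs_ofP [v ->].
  by apply/imfset2P; exists (val v); [exact: valP | exists (val (m v)); rewrite ?inE ?me ?andbT /=; first exact: valP].
apply/allP => t tQ; apply/cardfs1P; exists (pair_of m [` tQ]).
apply/fsetP => B; rewrite !inE /=; apply/andP/eqP.
  by case=> /pairs_ofP[u ->] tB; apply: pair_of_mem.
by move=> ->; split; [apply/pairs_ofP; exists [` tQ] | rewrite in_fset2 eqxx].
Qed.

Lemma pairs_of_inj : {in matchings e &, injective pairs_of}.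
Proof.
move=> m1 m2 m1M m2M E; apply/permP => v.
have: pair_of m1 v \in pairs_of m2 by rewrite -E; apply/pairs_ofP; exists v.
case/pairs_ofP=> u E1.
have: val v \in pair_of m2 u by rewrite -E1 fset21.
move/(pair_of_mem m2M) => E2; move: E1; rewrite E2.
have /matchingsP[m2e m2K] := m2M.
case/fset2_eq => [[_ /val_inj] //|[vE1 vE2]].
by apply/val_inj; rewrite vE2.
Qed.

(** Each vertex lies on exactly one edge of [P], and taking the other end is the involution; the
    coloring excludes loops. *)
Lemma pm_pairs_of P : perfect_matching G P ->
  exists2 m, m \in matchings e & pairs_of m = P.
Proof.
case/andP=> /fsubsetP sub /allP cov.
have irr t : ~~ e t t by apply/negP => /[dup] /e_col; case: (col t).
have uni (v : Q) B B' : B \in P -> B' \in P -> val v \in B -> val v \in B' -> B = B'.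
  move=> BP B'P vB vB'; have /cardfs1P[B0 /fsetP E] := cov _ (valP v).
  have := E B; have := E B'; rewrite !inE /= BP B'P vB vB' /=.
  by move/esym/eqP=> -> /esym/eqP.
have ex (v : Q) : exists u : Q, ([fset val v; val u] \in P) && e (val v) (val u).
  have /cardfs1P[B /fsetP/(_ B)] := cov _ (valP v).
  rewrite !inE /= eqxx => /andP[BP vB].
  have /imfset2P[t tQ [u]] := sub _ BP; rewrite !inE /= => /andP[uQ etu] EB.
  move: vB; rewrite EB in_fset2 => /orP[] /eqP E.
    by exists [` uQ]; rewrite /= E -EB BP etu.
  by exists [` tQ]; rewrite /= E fsetUC -EB BP e_sym etu.
pose f v := xchoose (ex v).
have fP v : [fset val v; val (f v)] \in P by case/andP: (xchooseP (ex v)).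
have fe v : e (val v) (val (f v)) by case/andP: (xchooseP (ex v)).
have fK : involutive f.
  move=> v; have := uni (f v) _ _ (fP v) (fP (f v)).
  rewrite fset22 fset21 => /(_ isT isT) /fset2_eq [[E _]|[E _]]; last exact/val_inj/esym.
  by have := fe v; rewrite -E (negbTE (irr _)).
exists (perm (can_inj fK)).
  by apply/matchingsP; split=> v; rewrite !permE.
apply/fsetP => B; apply/pairs_ofP/idP => [[v ->]|BP]; first by rewrite /pair_of permE.
have /imfset2P[t tQ [u]] := sub _ BP; rewrite !inE /= => /andP[uQ etu] EB.
exists [` tQ]; rewrite /pair_of permE.
apply: (uni [` tQ]) => //; first by rewrite EB fset21.
by rewrite fset21.
Qed.

Lemma prod_pairs_of m : m \in matchings e ->
  \prod_(B <- pairs_of m) w B = \prod_(v : Q | col (val v)) w (pair_of m v).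
Proof.
move=> mM; have /matchingsP[me mK] := mM.
rewrite -[RHS]big_filter -(big_map (pair_of m) xpredT w).
apply: perm_big; apply: uniq_perm; first exact: fset_uniq.
  rewrite map_inj_in_uniq ?filter_uniq ?index_enum_uniq // => u v.
  rewrite !mem_filter => /andP[cu _] /andP[cv _].
  case/fset2_eq => [[/val_inj //]|[E _]].
  by have := e_col (me v); rewrite -E cu cv.
move=> B; apply/pairs_ofP/mapP => [[v ->]|[v _ ->]]; last by exists v.
case cv: (col (val v)); first by exists v; rewrite // mem_filter cv mem_index_enum.
exists (m v); last by rewrite pair_of_sym.
by rewrite mem_filter mem_index_enum (e_col (me v)) cv.
Qed.

Lemma M_sum_matchings :
  M G = \sum_(m in matchings e) \prod_(v : Q | col (val v)) w (pair_of m v).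
Proof.
rewrite /M -big_filter.
under [RHS]eq_bigr => m mM do rewrite -(prod_pairs_of mM).
rewrite -big_enum /= -(big_map pairs_of xpredT (fun P => \prod_(B <- P) w B)).
apply: perm_big; apply: uniq_perm; first by rewrite filter_uniq ?fset_uniq.
  rewrite map_inj_in_uniq ?enum_uniq // => m1 m2; rewrite !mem_enum.
  exact: pairs_of_inj.
move=> P; rewrite mem_filter; apply/andP/mapP => [[/pm_pairs_of[m mM <-] _]|[m]].
  by exists m; rewrite ?mem_enum.
rewrite mem_enum => mM ->; have pm := pairs_of_pm mM; split=> //.
by rewrite fpowersetE; case/andP: pm.
Qed.

End MatchingsAsInvolutions.

(** * Factorization of the matching sum over two separate parts *)

Section Factorization.

Variables (K : choiceType) (G : wgraph K) (S1 S2 : {fset K}).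
Hypothesis vtxE : vtx G = S1 `|` S2.
Hypothesis S12 : [disjoint S1 & S2].
Hypothesis edgeP : forall B, B \in edges G ->
  (B != fset0) && ((B `<=` S1) || (B `<=` S2)).

Let in1 B t : B \in edges G -> t \in S1 -> t \in B -> B `<=` S1.
Proof.
move=> /edgeP/andP[_ /orP[] // /fsubsetP sB] tS1 /sB tS2.
by move: (fdisjointP S12 _ tS1); rewrite tS2.
Qed.

Let in2 B t : B \in edges G -> t \in S2 -> t \in B -> B `<=` S2.
Proof.
move=> /edgeP/andP[_ /orP[] // /fsubsetP sB] tS2 /sB tS1.
by move: (fdisjointP S12 _ tS1); rewrite tS2.
Qed.

Let not_both B : B \in edges G -> B `<=` S1 -> B `<=` S2 -> False.
Proof.
move=> /edgeP/andP[/fset0Pn[t tB] _] /fsubsetP/(_ t tB) t1 /fsubsetP/(_ t tB) t2.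
by move: (fdisjointP S12 _ t1); rewrite t2.
Qed.

(** Matchings of the parts are recovered from their union, which makes the correspondence in
    [M_disjoint] injective; their disjointness splits the product of weights. *)
Let pmU P1 P2 :
  perfect_matching (induced G S1) P1 -> perfect_matching (induced G S2) P2 ->
  [/\ perfect_matching G (P1 `|` P2),
     [fset B in P1 `|` P2 | B `<=` S1] = P1,
     [fset B in P1 `|` P2 | B `<=` S2] = P2 & [disjoint P1 & P2]].
Proof.
case/andP=> /fsubsetP s1 /allP c1 /andP[/fsubsetP s2 /allP c2].
have e1 B : B \in P1 -> (B \in edges G) /\ B `<=` S1.
  by move/s1; rewrite !inE /= => /andP[].
have e2 B : B \in P2 -> (B \in edges G) /\ B `<=` S2.
  by move/s2; rewrite !inE /= => /andP[].
split.
- apply/andP; split.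
    by apply/fsubsetP => B; rewrite inE => /orP[/e1[]|/e2[]].
  apply/allP => t; rewrite vtxE inE => /orP[tS|tS].
    rewrite -(eqP (c1 _ tS)); apply/eqP; congr (#|` _|); apply/fsetP => B.
    rewrite !inE /=; case: (boolP (t \in B)) => tB; rewrite ?andbF // !andbT.
    case: (boolP (B \in P2)) => BP; rewrite ?orbF // orbT.
    by case: (e2 _ BP) => Be B2; case: (not_both Be (in1 Be tS tB) B2).
  rewrite -(eqP (c2 _ tS)); apply/eqP; congr (#|` _|); apply/fsetP => B.
  rewrite !inE /=; case: (boolP (t \in B)) => tB; rewrite ?andbF // !andbT.
  case: (boolP (B \in P1)) => BP //=.
  by case: (e1 _ BP) => Be B1; case: (not_both Be B1 (in2 Be tS tB)).
- apply/fsetP => B; rewrite !inE /=.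
  case: (boolP (B \in P1)) => [/e1[]// | BP1] /=.
  by apply/negP => /andP[/e2[Be B2] B1]; apply: (not_both Be).
- apply/fsetP => B; rewrite !inE /=.
  case: (boolP (B \in P2)) => [/e2[_ ->]| BP2]; first by rewrite orbT.
  by rewrite orbF; apply/negP => /andP[/e1[Be B1] B2]; apply: (not_both Be).
- by apply/fdisjointP => B /e1[Be B1]; apply/negP => /e2[_ B2]; apply: (not_both Be).
Qed.

Let pm_split P : perfect_matching G P ->
  [/\ perfect_matching (induced G S1) [fset B in P | B `<=` S1],
     perfect_matching (induced G S2) [fset B in P | B `<=` S2] &
     P = [fset B in P | B `<=` S1] `|` [fset B in P | B `<=` S2]].
Proof.
case/andP=> /fsubsetP sP /allP cP; split.
- apply/andP; split.
    by apply/fsubsetP => B; rewrite !inE /= => /andP[/sP -> ->].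
  apply/allP => t tS; rewrite -(eqP (cP t _)); last by rewrite vtxE inE tS.
  apply/eqP; congr (#|` _|); apply/fsetP => B; rewrite !inE /=.
  case: (boolP (t \in B)) => tB; rewrite ?andbF // !andbT.
  by case: (boolP (B \in P)) => // /sP Be; rewrite (in1 Be tS tB).
- apply/andP; split.
    by apply/fsubsetP => B; rewrite !inE /= => /andP[/sP -> ->].
  apply/allP => t tS; rewrite -(eqP (cP t _)); last by rewrite vtxE inE tS orbT.
  apply/eqP; congr (#|` _|); apply/fsetP => B; rewrite !inE /=.
  case: (boolP (t \in B)) => tB; rewrite ?andbF // !andbT.
  by case: (boolP (B \in P)) => // /sP Be; rewrite (in2 Be tS tB).
apply/fsetP => B; rewrite !inE /= -andb_orr.
by case: (boolP (B \in P)) => // /sP/edgeP/andP[_ ->].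
Qed.

Lemma M_disjoint : M G = M (induced G S1) * M (induced G S2).
Proof.
rewrite /M -[LHS]big_filter -[X in _ = X * _]big_filter -[X in _ = _ * X]big_filter.
rewrite big_distrlr /=.
set r1 := filter _ _; set r2 := filter _ _; set r3 := filter _ _.
have in_r S P : (P \in [seq P <- fpowerset (edges (induced G S)) |
    perfect_matching (induced G S) P]) = perfect_matching (induced G S) P.
  rewrite mem_filter fpowersetE; case: (boolP (perfect_matching _ P)) => //.
  by case/andP=> ->.
pose F P := \prod_(B <- P) weight G B.
transitivity (\sum_(P <- [seq P1 `|` P2 | P1 <- r2, P2 <- r3]) F P).
  apply: perm_big; apply: uniq_perm; first by rewrite filter_uniq ?fset_uniq.
    apply: allpairs_uniq; rewrite ?filter_uniq ?fset_uniq //.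
    move=> [P1 P2] [P1' P2'] /allpairsP[[? ?] /= [i1 i2 [-> ->]]].
    move=> /allpairsP[[? ?] /= [i1' i2' [-> ->]]] /= E.
    move: i1 i2 i1' i2'; rewrite !in_r => i1 i2 i1' i2'.
    have [_ F1 F2 _] := pmU i1 i2; have [_ E1 E2 _] := pmU i1' i2'.
    by congr (_, _); [rewrite -[LHS]F1 E E1 | rewrite -[LHS]F2 E E2].
  move=> P; apply/idP/allpairsP => [|[[P1 P2] /= []]].
    rewrite mem_filter => /andP[/pm_split[i1 i2 E] _].
    by exists ([fset B in P | B `<=` S1], [fset B in P | B `<=` S2]); rewrite !in_r.
  rewrite !in_r => i1 i2 ->; have [pm _ _ _] := pmU i1 i2.
  by rewrite mem_filter pm fpowersetE; case/andP: pm.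
rewrite big_allpairs_dep big_seq [RHS]big_seq; apply: eq_bigr => P1; rewrite in_r => i1.
rewrite big_seq [RHS]big_seq; apply: eq_bigr => P2; rewrite in_r => i2.
have [_ _ _ D] := pmU i1 i2; rewrite /F -big_cat; apply: perm_big.
apply: uniq_perm; first exact: fset_uniq.
  rewrite cat_uniq !fset_uniq andbT /=; apply/hasPn => B B2; apply/negP => B1.
  by move: (fdisjointP D _ B1); rewrite B2.
by move=> B; rewrite mem_cat inE.
Qed.

End Factorization.

(** * Adjacency of unit triangles in coordinates *)

(** Neighbours in a row share a slanted edge; neighbours in a column share a horizontal edge, which
    is the upper edge of a down-pointing triangle and the lower edge of an up-pointing one. *)
Lemma adjacentE (t u : tri) : adjacent t u =
  ((t.2 == u.2) && ((u.1 == t.1 + 1) || (t.1 == u.1 + 1)))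
  || ((t.1 == u.1) && (((u.2 == t.2 + 1) && ~~ up t) || ((t.2 == u.2 + 1) && up t))).
Proof.
case: t u => [k s] [k' s']; rewrite /adjacent /corners /=.
have eqT (x y : int) : x = y -> (x == y) = true by move=> ->; rewrite eqxx.
have eqF (x y : int) : x <> y -> (x == y) = false by move/eqP/negbTE.
(* Beyond these offsets the triangles have no common corner; within each case [lia] decides every
   comparison of corners. *)
have [Es|[Es|[Es|Es]]] : s' = s \/ s' = s + 1 \/ s' = s - 1 \/ `|s' - s| > 1 by lia.
all: case E1: (up (k, s)); case E2: (up (k', s')); rewrite /= !inE !xpair_eqE;
 move: E1 E2; rewrite /up /=;
 (have [Ek|[Ek|[Ek|[Ek|[Ek|Ek]]]]] : k' = k \/ k' = k + 1 \/ k' = k - 1 \/ k' = k + 2 \/ k' = k - 2 \/ `|k' - k| > 2 by lia);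
 move=> E1 E2; try (exfalso; lia);
 repeat match goal with |- context [@eq_op _ ?x ?y] =>
    first [rewrite (eqT x y); [|lia] | rewrite (eqF x y); [|lia]] end; done.
Qed.

Lemma adjacent_sym : symmetric adjacent.
Proof. by move=> [k s] [k' s']; rewrite !adjacentE /up /=; lia. Qed.

Lemma adjacent_up t u : adjacent t u -> up u = ~~ up t.
Proof. by case: t u => [k s] [k' s']; rewrite !adjacentE /up /=; lia. Qed.

Lemma adjacent_mirror n t u : adjacent (mirror n t) (mirror n u) = adjacent t u.
Proof. by case: t u => [k s] [k' s']; rewrite !adjacentE /up /mirror /=; lia. Qed.

Lemma up_mirror n t : up (mirror n t) = up t.
Proof. by case: t => k s; rewrite /up /mirror /=; lia. Qed.

(** * The reflection in l' and the strip it fixes *)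

Section Geometry.

Variables (l T a b c : int) (Q : {fset tri}).

(* The hexagon with axis x = l, northern side on y = T, and sides a, b, c
   (northern, northeastern, southeastern); its row s is an interval centered at
   l.  The northwestern rows are those with T - b <= s. *)
Definition in_hex (t : tri) : bool :=
  [&& T - b - c <= t.2, t.2 < T, `|t.1 - l| <= a + (T - 1 - t.2)
    & `|t.1 - l| <= a + 2 * b - T + t.2].

Hypothesis a_gt0 : 0 < a.
Hypothesis b_gt0 : 0 < b.
Hypothesis c_gt0 : 0 < c.
(** This is the length of the southern side; the next hypothesis says that the northwestern corner
    [(l - a, T)] is a lattice point. *)
Hypothesis d_gt0 : 0 < a + b - c.
Hypothesis corner_parity : (2 %| l - a + T)%Z.
Hypothesis Q_hex : forall t, t \in Q -> in_hex t.
Hypothesis Q_mirror : forall t, t \in Q -> in_hex (mirror (l + 1) t) ->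
  mirror (l + 1) t \in Q.
Hypothesis Q_strip : forall t, in_hex t -> ~~ in_hex (mirror (l + 1) t) -> t \in Q.

Definition tri_col (v : Q) : int := (val v).1.
Definition tri_row (v : Q) : int := (val v).2.
Local Notation col := tri_col.
Local Notation row := tri_row.

Lemma valE v : val v = (col v, row v).
Proof. by rewrite /col /row -surjective_pairing. Qed.

Lemma tri_inj u v : col u = col v -> row u = row v -> u = v.
Proof. by move=> E1 E2; apply: val_inj; rewrite !valE E1 E2. Qed.

Lemma hexP (v : Q) : [/\ T - b - c <= row v, row v < T,
  l - (a + T - 1 - row v) <= col v <= l + (a + T - 1 - row v)
 & l - (a + 2 * b - T + row v) <= col v <= l + (a + 2 * b - T + row v)].
Proof. by move: (Q_hex (valP v)); rewrite valE /in_hex /= => h; split; lia. Qed.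

Definition strip : {set Q} := [set v | ~~ in_hex (mirror (l + 1) (val v))].
Definition line : {set Q} := [set v | crossed (l + 1) (val v)].

Lemma lineE v : (v \in line) = (col v == l + 1). Proof. by rewrite inE. Qed.

(** A row has columns from [l - W] to [l + W], with W the smaller of two bounds. Its reflection in
    [x = l + 1] begins at [l - W + 2], so the two leftmost columns have no image in the row. *)
Lemma stripE v : (v \in strip) = (col v <= l + 1 - (a + T - 1 - row v))
  || (col v <= l + 1 - (a + 2 * b - T + row v)).
Proof. by rewrite inE valE /in_hex /mirror /=; case: (hexP v) => ? ? ? ?; lia. Qed.

Lemma line_strip v : v \in line -> v \notin strip.
Proof. by rewrite lineE stripE; case: (hexP v); lia. Qed.

(** The default value [v] of [insubd] makes this the identity on the strip. *)
Let refl (v : Q) : Q := insubd v (mirror (l + 1) (val v)).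

Let val_refl v : val (refl v) = if v \in strip then val v else mirror (l + 1) (val v).
Proof.
rewrite /refl val_insubd inE; case: (boolP (in_hex _)) => hm /=.
  by rewrite Q_mirror ?valP.
by case: ifP => // /Q_hex; rewrite (negbTE hm).
Qed.

Let col_refl v : col (refl v) = if v \in strip then col v else 2 * (l + 1) - col v.
Proof. by rewrite /col val_refl; case: ifP. Qed.

Let row_refl v : row (refl v) = row v.
Proof. by rewrite /row val_refl; case: ifP. Qed.

Let reflK : involutive refl.
Proof.
move=> v; apply: tri_inj; rewrite ?row_refl // !col_refl.
have -> : (refl v \in strip) = (v \in strip).
  rewrite stripE row_refl col_refl; case: ifP => vS; first by rewrite -stripE.
  by move: vS; rewrite stripE; case: (hexP v) => ????; lia.
by case: (v \in strip); lia.
Qed.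

Definition reflection : {perm Q} := perm (can_inj reflK).
Local Notation q := reflection.

Lemma reflectionK v : q (q v) = v. Proof. by rewrite !permE reflK. Qed.

Lemma col_q v : col (q v) = if v \in strip then col v else 2 * (l + 1) - col v.
Proof. by rewrite permE col_refl. Qed.

Lemma row_q v : row (q v) = row v.
Proof. by rewrite permE row_refl. Qed.

Lemma val_q v : val (q v) = if v \in strip then val v else mirror (l + 1) (val v).
Proof. by rewrite permE val_refl. Qed.

Lemma reflection_fix v : (q v == v) = (v \in line) || (v \in strip).
Proof.
apply/eqP/idP => [/(congr1 col)|]; rewrite lineE ?col_q.
  by case: ifP => vS; rewrite ?vS ?orbT // orbF; lia.
by move=> H; apply: tri_inj; rewrite ?row_q // col_q; case: ifP H => //=; lia.
Qed.

Definition on_right (v : Q) : bool := right_of (l + 1) (val v).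

Lemma on_right_q v : v \notin line -> v \notin strip -> on_right (q v) = ~~ on_right v.
Proof.
rewrite /on_right /right_of -/(col v) -/(col (q v)) lineE col_q.
by move=> vL /negbTE ->; lia.
Qed.

Lemma strip_left v : v \in strip -> on_right v = false.
Proof.
rewrite /on_right /right_of -/(col v) stripE.
by case: (hexP v) => ? ? ? ?; lia.
Qed.

Local Notation Ms := (@matchings _ Q adjacent).

Section OneMatching.

Variable m : {perm Q}.
Hypothesis mM : m \in Ms.

Lemma matchK v : m (m v) = v. Proof. by case/matchingsP: mM. Qed.

Lemma match_adjacent v : adjacent (val v) (val (m v)).
Proof. by case/matchingsP: mM. Qed.

Lemma match_up v : up (val (m v)) = ~~ up (val v).
Proof. exact/adjacent_up/match_adjacent. Qed.

Lemma match_neq v : m v != v.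
Proof. by apply/eqP => E; have := match_up v; rewrite E; case: up. Qed.

Lemma matchP v :
  (row (m v) = row v /\ (col (m v) = col v + 1 \/ col (m v) = col v - 1)) \/
  (col (m v) = col v /\ (row (m v) = row v + 1 /\ (2 %| col v + row v)%Z \/
                         row (m v) = row v - 1 /\ ~~ (2 %| col v + row v)%Z)).
Proof. by have := match_adjacent v; rewrite adjacentE /up !valE /=; lia. Qed.

(** Away from the strip [q] is a genuine reflection and preserves adjacency. *)
Lemma flip_matching (U : {set Q}) :
    (forall v, (q v \in U) = (v \in U)) -> (forall v, (m v \in U) = (v \in U)) ->
    (forall v, v \in U -> v \notin strip) ->
  flip q U m \in Ms.
Proof.
move=> qU mU US; apply/matchingsP; split=> v; rewrite !(flipE reflectionK qU) //.
  case: ifP => vU; last exact: match_adjacent.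
  have E u : u \in U -> val (q u) = mirror (l + 1) (val u).
    by move=> uU; rewrite permE val_refl (negbTE (US _ uU)).
  rewrite E ?mU ?qU // -{1}[v]reflectionK E ?qU // adjacent_mirror.
  exact: match_adjacent.
by case: (boolP (v \in U)) => vU; rewrite ?qU ?mU ?qU ?vU ?reflectionK ?matchK ?reflectionK // (negbTE vU).
Qed.

(** * Triangles matched out of the strip *)

Definition escaping : {set Q} := [set v in strip | m v \notin strip].

Lemma escapingE v : (v \in escaping) = (v \in strip) && (m v \notin strip).
Proof. by rewrite inE. Qed.

(** All neighbours of an outer triangle of the strip belong to the strip, so only inner triangles
    can escape. *)
Lemma escaping_col v : v \in escaping ->
  if T - b <= row v then col v = l + 1 - (a + T - 1 - row v)
  else col v = l + 1 - (a + 2 * b - T + row v).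
Proof.
rewrite escapingE !stripE; have := matchP v; case: (hexP v) (hexP (m v)) => ? ? ? ? [? ? ? ?].
by case: ifP; lia.
Qed.

Lemma escaping_up v : v \in escaping -> up (val v) = (row v < T - b).
Proof. by move/escaping_col; rewrite valE /up /=; case: ifP; lia. Qed.

(* In the strip, an outer triangle above the line y = T - b can only be matched
   to an inner one above that line, except in the lowest of these rows; as there
   are as many outer as inner triangles, at most one inner triangle is left. *)
Let half (nw : bool) : {set Q} := [set v in strip | (T - b <= row v) == nw].

Let sh (i : int) (v : Q) : Q := insubd v ((col v + i, row v) : tri).

Let val_sh i v : in_hex (col v + i, row v) -> ~~ in_hex (mirror (l + 1) (col v + i, row v)) ->
  val (sh i v) = (col v + i, row v).
Proof. by move=> h1 h2; rewrite /sh val_insubd Q_strip. Qed.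

Let outerb (v : Q) := ~~ in_hex (col v - 1, row v).

Let outerE v : v \in strip -> outerb v =
  if T - b <= row v then col v == l - (a + T - 1 - row v)
  else col v == l - (a + 2 * b - T + row v).
Proof. by rewrite stripE /outerb /in_hex /=; case: (hexP v) => ????; case: ifP; lia. Qed.

Let sh_out v : v \in strip -> outerb v -> [/\ col (sh 1 v) = col v + 1,
  row (sh 1 v) = row v, sh 1 v \in strip & ~~ outerb (sh 1 v)].
Proof.
move=> vS vo; have E : val (sh 1 v) = (col v + 1, row v).
  move: vo; rewrite outerE // => vo.
  by apply: val_sh; rewrite /in_hex /mirror /=; move: vS vo; rewrite stripE;
    case: (hexP v) => ????; case: ifP; lia.
have Ec : col (sh 1 v) = col v + 1 by rewrite /col E.
have Er : row (sh 1 v) = row v by rewrite {1}/row E.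
have S' : sh 1 v \in strip.
  by move: vo; rewrite outerE // stripE Ec Er; move: vS; rewrite stripE;
    case: (hexP v) => ????; case: ifP; lia.
split=> //; rewrite outerE // Ec Er.
by move: vS vo => /[dup] vS; rewrite stripE => ?; rewrite outerE //;
  case: (hexP v) => ????; case: ifP; lia.
Qed.

Let sh_in v : v \in strip -> ~~ outerb v -> [/\ col (sh (-1) v) = col v + (-1),
  row (sh (-1) v) = row v, sh (-1) v \in strip & outerb (sh (-1) v)].
Proof.
move=> vS vo; have E : val (sh (-1) v) = (col v + (-1), row v).
  move: vo; rewrite outerE // => vo.
  by apply: val_sh; rewrite /in_hex /mirror /=; move: vS vo; rewrite stripE;
    case: (hexP v) => ????; case: ifP; lia.
have Ec : col (sh (-1) v) = col v + (-1) by rewrite /col E.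
have Er : row (sh (-1) v) = row v by rewrite {1}/row E.
have S' : sh (-1) v \in strip.
  by move: vo; rewrite outerE // stripE Ec Er; move: vS; rewrite stripE;
    case: (hexP v) => ????; case: ifP; lia.
split=> //; rewrite outerE // Ec Er.
by move: vS vo => /[dup] vS; rewrite stripE => ?; rewrite outerE //;
  case: (hexP v) => ????; case: ifP; lia.
Qed.

Lemma even_strip : ~~ odd #|strip|.
Proof.
pose f v := if outerb v then sh 1 v else sh (-1) v.
apply: (even_card_involution (f := f)) => v vS; rewrite /f.
- by case: (boolP (outerb v)) => vo; [case: (sh_out vS vo) | case: (sh_in vS vo)].
- case: (boolP (outerb v)) => vo.
    have [Ec Er S' o'] := sh_out vS vo; rewrite (negbTE o').
    have [Ec' Er' _ _] := sh_in S' o'; apply: tri_inj; lia.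
  have [Ec Er S' o'] := sh_in vS vo; rewrite o'.
  have [Ec' Er' _ _] := sh_out S' o'; apply: tri_inj; lia.
- apply/eqP => /(congr1 col).
  by case: (boolP (outerb v)) => vo; [case: (sh_out vS vo) | case: (sh_in vS vo)]; lia.
Qed.

(** The strip is even, and its triangles that do not escape are matched among themselves. *)
Lemma even_escaping : ~~ odd #|escaping|.
Proof.
have := even_strip; have eS : escaping \subset strip.
  by apply/subsetP => v; rewrite inE => /andP[].
rewrite -(cardsID escaping strip) (setIidPr eS) oddD.
suff /negbTE -> : ~~ odd #|strip :\: escaping| by rewrite addbF.
apply: (even_card_involution (f := m)) => v; rewrite ?matchK ?match_neq //.
rewrite !in_setD !escapingE matchK.
by do 2 case: (_ \in strip).
Qed.

Lemma escaping_half (nw : bool) :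
  (#|[set v in escaping | (T - b <= row v)%R == nw]| <= 1)%N.
Proof.
set E := [set _ in _ | _].
pose O := [set v in half nw | outerb v].
pose J := [set v in half nw | ~~ outerb v].
(* The row next to the line [y = T - b], the only one of this half whose outer triangle can be
   matched across that line. *)
pose er := if nw then T - b else T - b - 1.
pose O' := [set v in O | row v != er].
have cJO : (#|J| <= #|O|)%N.
  have inj : {in J &, injective (sh (-1))}.
    move=> u v; rewrite !in_set => /andP[/andP[uS _] uo] /andP[/andP[vS _] vo] E1.
    have [|uc ur _ _] := sh_in _ uo; first by rewrite inE.
    have [|vc vr _ _] := sh_in _ vo; first by rewrite inE.
    by move: (congr1 col E1) (congr1 row E1) => ? ?; apply: tri_inj; lia.
  rewrite -(card_in_imset inj); apply/subset_leq_card/subsetP => _ /imsetP[v + ->].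
  rewrite !in_set => /andP[/andP[vS vh] vo]; have [|_ vr + o'] := sh_in _ vo; first by rewrite inE.
  by rewrite inE => ->; rewrite o' vr vh.
have cOO' : (#|O| <= #|O'| + 1)%N.
  rewrite -(cardsID [set v | row v != er] O); apply: leq_add.
    by apply/subset_leq_card/subsetP => v; rewrite !inE.
  apply/card_le1P => u; rewrite !in_set negbK => /andP[/eqP eu /andP[/andP[uS uh] uo]] v.
  rewrite !in_set negbK; apply/idP/eqP => [/andP[/eqP ev /andP[/andP[vS vh] vo]]|->]; last first.
    by rewrite uS uh uo eu eqxx.
  have uS' : u \in strip by rewrite inE.
  have vS' : v \in strip by rewrite inE.
  apply: tri_inj; last by rewrite eu.
  by move: uo vo; rewrite !outerE // ev eu; case: ifP => _ /eqP -> /eqP ->.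
(* Mates of [O'] are inner triangles matched inside the strip, hence distinct from those of [E].
   Together with the two bounds above this leaves room for at most one element of [E]. *)
have cO'E : (#|O'| + #|E| <= #|J|)%N.
  rewrite -(card_imset _ (@perm_inj _ m)) -cardsUI.
  have -> : m @: O' :&: E = set0.
    apply/setP => v; rewrite !in_setI in_set0; apply/negP => /andP[/imsetP[u + ->]].
    by rewrite !inE matchK => /andP[/andP[/andP[-> _] _] _]; rewrite /= andbF.
  rewrite cards0 addn0; apply/subset_leq_card/subsetP => v; rewrite in_setU => /orP[].
    case/imsetP=> u + ->; rewrite 2!inE => /andP[/andP[+ uo] ur].
    rewrite 2!inE => /andP[uS uh].
    have uS' : u \in strip by rewrite inE.
    have mS : m u \in strip.
      move: uo ur uh; rewrite outerE // stripE /er; have := matchP u.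
      by case: (hexP u) (hexP (m u)) => ? ? ? ? [? ? ? ?]; case: (nw); case: ifP; lia.
    move: (mS); rewrite !inE => ->.
    move: uo ur uh; rewrite !outerE // /er; have := matchP u.
    by case: (hexP u) (hexP (m u)) => ? ? ? ? [? ? ? ?]; case: (nw); case: ifP; case: ifP; lia.
  rewrite inE => /andP[vE vh]; have vS : v \in strip by move: vE; rewrite inE => /andP[].
  move: (vS); rewrite !inE => ->; rewrite vh /= outerE //.
  by have := escaping_col vE; case: ifP; lia.
by lia.
Qed.

Lemma escaping_below u v : u \in escaping -> v \in escaping -> u != v ->
  T - b <= row u -> row v < T - b.
Proof.
move=> uE vE uv ur; rewrite ltNge; apply/negP => vr.
have /card_le1P/(_ u) := escaping_half true; rewrite inE uE ur => /(_ isT v).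
by rewrite in_set vE vr /= inE eq_sym (negbTE uv).
Qed.

Lemma escaping_above u v : u \in escaping -> v \in escaping -> u != v ->
  row u < T - b -> T - b <= row v.
Proof.
move=> uE vE uv ur; rewrite leNgt; apply/negP => vr.
have /card_le1P/(_ u) := escaping_half false; rewrite inE uE leNgt ur => /(_ isT v).
by rewrite in_set vE leNgt vr /= inE eq_sym (negbTE uv).
Qed.

Lemma card_escaping : (#|escaping| <= 2)%N.
Proof.
have := leq_add (escaping_half true) (escaping_half false).
rewrite -cardsUI; apply: leq_trans; apply: leq_trans (leq_addr _ _).
apply/subset_leq_card/subsetP => v vE; rewrite in_setU in_set vE in_set vE.
by case: (T - b <= _).
Qed.


(** * The plane folded along l' *)

Definition dist (v : Q) : int := `|col v - (l + 1)|.

Lemma dist_q v : dist (q v) = dist v.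
Proof. by rewrite /dist col_q; case: ifP; lia. Qed.

Lemma dist_line v : (v \in line) = (dist v == 0).
Proof. by rewrite lineE /dist; lia. Qed.

Lemma strip_dist v : v \in strip -> 0 < dist v.
Proof. by rewrite stripE /dist; case: (hexP v) => ????; lia. Qed.

Lemma match_dist v :
  (row (m v) = row v /\ (dist (m v) = dist v + 1 \/ dist v = dist (m v) + 1)) \/
  (dist (m v) = dist v /\ (row (m v) = row v + 1 \/ row v = row (m v) + 1)).
Proof. by rewrite /dist; case: (matchP v); lia. Qed.

(** [dist] and [row] are coordinates after folding, and two triangles that fold together are
    exchanged by [q]; a strip triangle is alone in its place because its mirror image is outside the
    hexagon. *)
Lemma same_place u v : dist u = dist v -> row u = row v -> u = v \/ u = q v.
Proof.
move=> Ed Er; have [Ec | Ec] : col u = col v \/ col u = 2 * (l + 1) - col v.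
- by move: Ed; rewrite /dist; lia.
- by left; apply: tri_inj.
case: (boolP (v \in strip)) => vS; last first.
  by right; apply: tri_inj; rewrite ?row_q // col_q (negbTE vS).
by exfalso; move: vS; rewrite stripE; case: (hexP v) (hexP u) => ???? [????]; lia.
Qed.

Lemma card_row_step (P : pred Q) s : #|[set u | P u && (s < row u)]| =
  (#|[set u | P u && (s + 1 < row u)%R]| + #|[set u | P u && (row u == s + 1)%R]|)%N.
Proof.
rewrite -(cardsID [set u | s + 1 < row u]); congr (_ + _)%N; apply: eq_card => u.
  by rewrite in_setI !in_set; case: (P u) => //=; lia.
by rewrite in_setD !in_set; case: (P u) => //=; lia.
Qed.

(** * Parity of ray crossings with a union of paths *)

Section Separation.

Variable K : {set Q}.
Hypothesis Kq : forall v, (q v \in K) = (v \in K).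
Hypothesis Km : forall v, (m v \in K) = (v \in K).
Hypothesis K_strip : forall v, v \in K -> v \in strip -> v \in escaping.

(* [crossings d s] counts the edges of K met by the horizontal ray at height
   s + 1, folded along l', starting at distance d from l' and going outwards.
   Its parity changes when the ray passes an end of K in the strip, which the
   second summand of [enclosed] compensates. *)
Let crossings (d s : int) : nat :=
  #|[set u in K | [&& row u == s, d < dist u & row (m u) == s + 1]]|.

Let strip_above (s : int) : nat := #|[set u in K | (u \in strip) && (s < row u)]|.

Definition enclosed (d s : int) : bool := odd (crossings d s) (+) odd (strip_above s).

(** The parity of the set [A] of points of [K] in row [s + 1] beyond distance [d] is found twice. By
    [q], only strip points count. By [m], [A] splits into points matched downwards, upwards, inside
    [A], and horizontally to distance [d]; those matched inside [A] are even in number. *)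
Let crossings_step d s : 0 <= d ->
  odd (crossings d s) (+) odd (crossings d (s + 1)) =
  odd #|[set u in K | [&& u \in strip, row u == s + 1 & d < dist u]]|
  (+) odd #|[set u in K | [&& row u == s + 1, dist u == d, row (m u) == s + 1 & d < dist (m u)]]|.
Proof.
move=> d_ge0; pose A := [set u in K | (row u == s + 1) && (d < dist u)].
have oddA : odd #|A| = odd #|[set u in K | [&& u \in strip, row u == s + 1 & d < dist u]]|.
  rewrite (odd_card_involution (f := q)); first 1 last.
  - by move=> u; rewrite !(in_set (fun _ => _)) Kq row_q dist_q.
  - by move=> u _; rewrite reflectionK.
  congr (odd _); apply: eq_card => u; rewrite in_set in_set [RHS]in_set reflection_fix dist_line.
  case: (u \in K) => //=; case: (row u == s + 1) => /=; rewrite ?andbF //.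
  by case: (u \in strip) => /=; rewrite ?andbT ?orbT ?andbT ?orbF //; lia.
pose Adown := [set u in A | row (m u) == s].
pose Aup := [set u in A | row (m u) == s + 2].
pose Ain := [set u in A | (row (m u) == s + 1) && (d < dist (m u))].
pose Aout := [set u in A | (row (m u) == s + 1) && (dist (m u) == d)].
have cA : #|A| = (#|Adown| + #|Aup| + #|Ain| + #|Aout|)%N.
  have split2 (B : {set Q}) (P : pred Q) : #|B| = (#|[set u in B | P u]| + #|[set u in B | ~~ P u]|)%N.
    rewrite -(cardsID [set u | P u] B); congr (_ + _)%N; apply: eq_card => u.
      by rewrite in_setI !in_set.
    by rewrite in_setD !in_set andbC.
  rewrite (split2 A (fun u => row (m u) == s)) -!addnA; congr (_ + _)%N.
  rewrite (split2 _ (fun u => row (m u) == s + 2)); congr (_ + _)%N.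
    apply: eq_card => u; rewrite !in_set -!andbA.
    by do 3 case: (X in X && _) => //=; lia.
  rewrite (split2 _ (fun u => d < dist (m u))); congr (_ + _)%N; apply: eq_card => u.
    rewrite !in_set -!andbA; case: (u \in K) => //=; have := match_dist u; lia.
  rewrite !in_set -!andbA; case: (u \in K) => //=; have := match_dist u; lia.
have cdown : #|Adown| = crossings d s.
  rewrite -(card_imset _ (@perm_inj _ m)); apply: eq_card => u.
  apply/imsetP/idP => [[v + ->]|]; rewrite !in_set.
    by rewrite Km matchK; case: (v \in K) => //=; have := match_dist v; lia.
  case/andP=> uK H; exists (m u); last by rewrite matchK.
  by rewrite !in_set matchK Km uK /=; move: H; have := match_dist u; lia.
have cup : #|Aup| = crossings d (s + 1).
  by apply: eq_card => u; rewrite !in_set; case: (u \in K) => //=; lia.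
have cin : ~~ odd #|Ain|.
  apply: (even_card_involution (f := m)) => u; rewrite ?matchK ?match_neq //.
  by rewrite !in_set matchK Km; case: (u \in K) => //=; lia.
have cout : #|Aout| = #|[set u in K |
    [&& row u == s + 1, dist u == d, row (m u) == s + 1 & d < dist (m u)]]|.
  rewrite -(card_imset _ (@perm_inj _ m)); apply: eq_card => u.
  apply/imsetP/idP => [[v + ->]|]; rewrite !in_set.
    by rewrite Km matchK; case: (v \in K) => //=; lia.
  case/andP=> uK H; exists (m u); last by rewrite matchK.
  by rewrite !in_set matchK Km uK /=; lia.
rewrite -oddA cA !oddD (negbTE cin) cdown cup cout addbF.
by do 3 case: (odd _).
Qed.

Let strip_above_step s : odd (strip_above s) (+) odd (strip_above (s + 1)) =
  odd #|[set u in K | (u \in strip) && (row u == s + 1)]|.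
Proof.
pose P u := (u \in K) && (u \in strip).
have E s' : strip_above s' = #|[set u | P u && (s' < row u)]|.
  by apply: eq_card => u; rewrite [LHS]in_set [RHS]in_set andbA.
have -> : #|[set u in K | (u \in strip) && (row u == s + 1)]| =
    #|[set u | P u && (row u == s + 1)]|.
  by apply: eq_card => u; rewrite [LHS]in_set [RHS]in_set andbA.
rewrite !E (card_row_step P s).
by rewrite oddD; do 2 case: (odd _).
Qed.

(** If the strip points of [K] in the row lie beyond distance [d], the two contributions of the
    strip cancel. *)
Let enclosed_step d s : 0 <= d ->
  (forall u, u \in K -> u \in strip -> row u = s + 1 -> d < dist u) ->
  enclosed d s (+) enclosed d (s + 1) =
  odd #|[set u in K | [&& row u == s + 1, dist u == d, row (m u) == s + 1 & d < dist (m u)]]|.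
Proof.
move=> d0 H; rewrite /enclosed addbACA crossings_step // strip_above_step.
have -> : [set u in K | [&& u \in strip, row u == s + 1 & d < dist u]] =
          [set u in K | (u \in strip) && (row u == s + 1)].
  apply/setP => u; rewrite [LHS]in_set [RHS]in_set.
  case: (boolP (u \in K)) => //= uK; case: (boolP (u \in strip)) => //= uS.
  by case: (row u =P s + 1) => //= E; rewrite H.
by rewrite addbC addbA addbb.
Qed.

Let no_vertex s : T <= s -> enclosed 0 s = false.
Proof.
move=> hs; rewrite /enclosed /crossings /strip_above.
have -> : [set u in K | [&& row u == s, 0 < dist u & row (m u) == s + 1]] = set0.
  by apply/setP => u; rewrite in_set in_set0; case: (hexP u) => ????; case: (u \in K) => //=; lia.
have -> : [set u in K | (u \in strip) && (s < row u)] = set0; last by rewrite cards0.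
by apply/setP => u; rewrite in_set in_set0; case: (hexP u) => ????; case: (u \in K) => //=; lia.
Qed.

(** Downward induction on [s] from [T], where nothing is left above; at [d = 0] each step adds the
    points of l' in row [s + 1] that are matched off l'. *)
Lemma enclosed_line s :
  enclosed 0 s = odd #|[set u in K | [&& u \in line, m u \notin line & s < row u]]|.
Proof.
have [n] : exists n : nat, T - s <= n%:Z by exists `|T - s|%N; lia.
elim: n s => [|n IH] s hs.
  rewrite no_vertex; last by lia.
  have -> : [set u in K | [&& u \in line, m u \notin line & s < row u]] = set0; last by rewrite cards0.
  apply/setP => u; rewrite in_set in_set0; case: (hexP u) => ????.
  by case: (u \in K) => //=; lia.
have step := @enclosed_step 0 s (lexx 0) (fun u _ uS _ => strip_dist uS).
have {}IH := IH (s + 1); rewrite -[enclosed 0 s](addbK (enclosed 0 (s + 1))) step IH; last by lia.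
have -> : [set u in K | [&& row u == s + 1, dist u == 0, row (m u) == s + 1 & 0 < dist (m u)]] =
   [set u in K | [&& u \in line, m u \notin line & row u == s + 1]].
  apply/setP => u; rewrite [LHS]in_set [RHS]in_set !dist_line; have := match_dist u.
  by case: (u \in K) => //=; rewrite /dist; lia.
pose P u := [&& u \in K, u \in line & m u \notin line].
have E s' : #|[set u in K | [&& u \in line, m u \notin line & s' < row u]]| =
    #|[set u | P u && (s' < row u)]|.
  by apply: eq_card => u; rewrite [LHS]in_set [RHS]in_set /P -!andbA.
have -> : #|[set u in K | [&& u \in line, m u \notin line & row u == s + 1]]| =
    #|[set u | P u && (row u == s + 1)]|.
  by apply: eq_card => u; rewrite [LHS]in_set [RHS]in_set /P -!andbA.
by rewrite !E (card_row_step P s) oddD addbC.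
Qed.

Let enclosed_up v : v \notin K -> ~~ ((v \in strip) && (m v \in strip)) ->
  row (m v) = row v + 1 -> dist (m v) = dist v ->
  enclosed (dist v) (row v) = enclosed (dist v) (row v + 1).
Proof.
move=> vK vS Er Ed; rewrite -[LHS](addbK (enclosed (dist v) (row v + 1))) enclosed_step.
- have -> : [set u in K | [&& row u == row v + 1, dist u == dist v,
      row (m u) == row v + 1 & dist v < dist (m u)]] = set0; last by rewrite cards0.
  apply/setP => u; rewrite in_set in_set0; apply/negP => /and5P[uK /eqP ur /eqP ud _ _].
  have [||Eu|Eu] := @same_place u (m v); rewrite ?ud ?Ed ?ur ?Er //.
    by move: uK; rewrite Eu Km (negbTE vK).
  by move: uK; rewrite Eu Kq Km (negbTE vK).
- by rewrite /dist; lia.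
(* [u] escapes, so it is the inner strip triangle of the row of [m v]. As [m v] is not the outer one
   by [vS], it is nearer to l' than [u]. *)
move=> u uK uS ur; have ue := escaping_col (K_strip uK uS).
have cu : col u <> col (m v).
  move=> E; have Eu : u = m v by apply: tri_inj; rewrite // ur Er.
  by move: uK; rewrite Eu Km (negbTE vK).
move: vS Ed; rewrite !stripE /dist; have := matchP v; rewrite Er.
case: (hexP u) (hexP v) (hexP (m v)) => ???? [????] [????].
by case: ifP ue; lia.
Qed.

(** Since [K] is stable under [q] and [m], none of its points folds onto [v] or [m v]; the start of
    the ray moves along the edge without meeting [K]. *)
Lemma enclosed_match v : v \notin K -> ~~ ((v \in strip) && (m v \in strip)) ->
  enclosed (dist (m v)) (row (m v)) = enclosed (dist v) (row v).
Proof.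
move=> vK vS; case: (match_dist v) => [[Er Ed]|[Ed [Er|Er]]].
- rewrite Er /enclosed; congr (odd _ (+) _); apply: eq_card => u.
  rewrite !(in_set (fun _ => _)); case: (boolP (u \in K)) => //= uK.
  case: (row u =P row v) => //= ur; congr (_ && _).
  have d1 : dist u <> dist v.
    move=> ud; case: (same_place ud ur) => Eu; move: uK; rewrite Eu ?Kq;
    by rewrite (negbTE vK).
  have d2 : dist u <> dist (m v).
    move=> ud; case: (same_place ud); rewrite ?ur ?Er // => Eu; move: uK; rewrite Eu ?Kq Km;
    by rewrite (negbTE vK).
  by lia.
- by rewrite Ed Er -enclosed_up.
rewrite -{1}Ed Er; have := @enclosed_up (m v); rewrite matchK -Er Km andbC.
by rewrite -Ed; apply.
Qed.

Lemma enclosed_q v : enclosed (dist (q v)) (row (q v)) = enclosed (dist v) (row v).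
Proof. by rewrite dist_q row_q. Qed.

(** Only the outer strip triangle of its row is farther from l' than [e], and it is not in [K]; the
    ray from [e] crosses nothing. *)
Lemma enclosed_escaping e : e \in escaping ->
  enclosed (dist e) (row e) = odd #|[set u in K | (u \in strip) && (row e < row u)]|.
Proof.
move=> eE; rewrite /enclosed.
have -> : crossings (dist e) (row e) = 0%N; last by [].
apply/eqP; rewrite cards_eq0; apply/eqP/setP => u; rewrite in_set in_set0.
apply/negP => /and4P[uK /eqP ur ud _]; have ec := escaping_col eE.
case: (boolP (u \in strip)) => uS.
  have uc := escaping_col (K_strip uK uS); move: uc ec ud; rewrite ur /dist.
  by case: (hexP u) (hexP e) => ???? [????]; case: ifP; lia.
move: uS ec ud; rewrite stripE ur /dist.
by case: (hexP u) (hexP e) => ???? [????]; case: ifP; lia.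
Qed.

End Separation.

(** * The paths of a matching and their ends *)

Lemma line_fix x : x \in line -> q x = x.
Proof. by move=> xL; apply/eqP; rewrite reflection_fix xL. Qed.

Lemma strip_fix x : x \in strip -> q x = x.
Proof. by move=> xS; apply/eqP; rewrite reflection_fix xS orbT. Qed.

Lemma fix_line_strip x : q x = x -> (x \in line) = (x \notin strip).
Proof.
move/eqP; rewrite reflection_fix => H; apply/idP/idP; first exact: line_strip.
by move/negbTE => E; move: H; rewrite E orbF.
Qed.

Local Notation pt := (partner q m).
Local Notation path := (porbit (walk q m)).

Let qK := reflectionK.
Let mK := matchK.
Let mN := match_neq.

Lemma path_q x v : x \in line -> (q v \in path x) = (v \in path x).
Proof.
move=> /line_fix qx.
by apply/idP/idP => /(porbit_q qK mK qx); rewrite ?qK.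
Qed.

Lemma path_m x v : x \in line -> (m v \in path x) = (v \in path x).
Proof.
move=> /line_fix qx.
by apply/idP/idP => /(porbit_m qK mK qx); rewrite ?mK.
Qed.

Lemma path_line x v : x \in line -> v \in path x -> q v = v -> v = x \/ v = pt x.
Proof. by move=> /line_fix qx; apply: (partner_uniq qK mK mN qx). Qed.

(** If [v] and [m v] were both in the strip, they would be the two ends of the path, which could not
    contain [x]. *)
Lemma path_escaping x v : x \in line -> v \in path x -> v \in strip -> v \in escaping.
Proof.
move=> xL vx vS; rewrite escapingE vS; apply/negP => mvS.
have qv := strip_fix vS; have qmv := strip_fix mvS.
have xv : x \in path v by rewrite porbit_sym.
case: (partner_uniq qK mK mN qv xv (line_fix xL)) => E.
  by move: (line_strip xL); rewrite E vS.
move: (line_strip xL).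
by rewrite E (partner_fixed_edge qK mK mN qv qmv) mvS.
Qed.

Lemma pt_fix x : x \in line -> q (pt x) = pt x.
Proof. by move=> /line_fix qx; apply: (partner_fix qK mK mN qx). Qed.

Lemma pt_neq x : x \in line -> pt x != x.
Proof. by move=> /line_fix qx; apply: (partner_neq qK mK mN qx). Qed.

Lemma ptK x : x \in line -> pt (pt x) = x.
Proof. by move=> /line_fix qx; apply: (partnerK qK mK mN qx). Qed.

Lemma pt_path x : pt x \in path x. Proof. exact: partner_porbit. Qed.

Lemma pt_line_strip x : x \in line -> (pt x \in line) = (pt x \notin strip).
Proof. by move=> xL; apply: fix_line_strip; apply: pt_fix. Qed.

Lemma pt_escaping x : x \in line -> pt x \in strip -> pt x \in escaping.
Proof. by move=> xL; apply: path_escaping xL (pt_path x). Qed.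

Lemma pt_edge x : x \in line -> m x \in line -> pt x = m x.
Proof. by move=> xL mxL; apply: (partner_fixed_edge qK mK mN); apply: line_fix. Qed.

Lemma escape_match x : x \in line -> pt x \in strip -> m x \notin line.
Proof.
move=> xL pS; apply/negP => mL; move: pS; rewrite (pt_edge xL mL).
exact/negP/line_strip.
Qed.

Lemma pt_match x : x \in line -> m x \notin line -> pt x \in line -> m (pt x) \notin line.
Proof.
move=> xL mxL pL; apply/negP => mpL.
by move: mxL; rewrite -{1}(ptK xL) (pt_edge pL mpL) mK pL.
Qed.

(* Discrete Jordan curve argument: a path disjoint from that of x stays on one
   side of it. *)
Lemma enclosed_pt x z : x \in line -> z \in line -> z \notin path x ->
  pt z \notin path x /\
  enclosed (path x) (dist (pt z)) (row (pt z)) = enclosed (path x) 0 (row z).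
Proof.
move=> xL zL zK.
have dz : dist z = 0 by apply/eqP; rewrite -dist_line.
rewrite -[in RHS]dz.
have Kq := path_q _ xL; have Km := path_m _ xL.
have Ke v := @path_escaping x v xL.
pose P v := v \notin path x /\
  enclosed (path x) (dist v) (row v) = enclosed (path x) (dist z) (row z).
apply: (@porbit_ind _ q m z P) (pt_path z) => // v vz [vK vE].
split; first by rewrite walkE Kq Km.
rewrite walkE enclosed_q // -vE; apply: enclosed_match => //.
case: (boolP (v \in strip)) => //= vS.
by have := path_escaping zL vz vS; rewrite escapingE => /andP[].
Qed.

Lemma odd_card_pair (x y : Q) (P : pred Q) : x != y ->
  odd #|[set u in [set x; y] | P u]| = P x (+) P y.
Proof.
move=> xy.
have -> : [set u in [set x; y] | P u] =
    (if P x then [set x] else set0) :|: (if P y then [set y] else set0).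
  apply/setP => u; rewrite in_set in_set2 in_setU; apply/idP/idP.
    by case/andP=> /orP[] /eqP -> ->; rewrite in_set1 eqxx ?orbT.
  by case/orP; case: ifP; rewrite ?in_set0 // in_set1 => Pz /eqP ->; rewrite eqxx ?orbT Pz.
case: (P x); case: (P y); rewrite ?setU0 ?set0U ?cards1 ?cards0 //.
by rewrite cards2 xy.
Qed.

Lemma enclosed_line_line x s : x \in line -> m x \notin line -> pt x \in line ->
  enclosed (path x) 0 s = (s < row x) (+) (s < row (pt x)).
Proof.
move=> xL mx pL; have Kq v := path_q v xL; have Km v := path_m v xL; have Ke v := @path_escaping x v xL.
rewrite enclosed_line //.
rewrite -(@odd_card_pair x (pt x) (fun u => s < row u)); last by rewrite eq_sym pt_neq.
congr (odd _); apply: eq_card => u; rewrite [LHS]in_set [RHS]in_set in_set2.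
apply/and4P/andP => [[uK uL _ us]|[/orP[]/eqP -> us]].
- by split=> //; case: (path_line xL uK (line_fix uL)) => ->; rewrite eqxx ?orbT.
- by split=> //; apply: porbit_id.
- by split=> //; [apply: pt_path | apply: pt_match].
Qed.

Lemma enclosed_line_strip x s : x \in line -> pt x \in strip ->
  enclosed (path x) 0 s = (s < row x).
Proof.
move=> xL pS; have mx := escape_match xL pS.
have Kq v := path_q v xL; have Km v := path_m v xL; have Ke v := @path_escaping x v xL.
rewrite enclosed_line //.
case: (boolP (s < row x)) => sx.
  suff -> : [set u in path x | [&& u \in line, m u \notin line & s < row u]] = [set x] by rewrite cards1.
  apply/setP => u; rewrite [LHS]in_set in_set1; apply/and4P/eqP => [[uK uL _ _]|->].
    case: (path_line xL uK (line_fix uL)) => // E.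
    by move: (line_strip uL); rewrite E pS.
  by split=> //; apply: porbit_id.
suff -> : [set u in path x | [&& u \in line, m u \notin line & s < row u]] = set0 by rewrite cards0.
apply/setP => u; rewrite [LHS]in_set in_set0; apply/negP => /and4P[uK uL _ us].
case: (path_line xL uK (line_fix uL)) => E.
  by move: sx; rewrite -E us.
by move: (line_strip uL); rewrite E pS.
Qed.

Lemma enclosed_escaping_line x e : x \in line -> pt x \in line -> e \in escaping ->
  enclosed (path x) (dist e) (row e) = false.
Proof.
move=> xL pL eE; have Kq v := path_q v xL; have Km v := path_m v xL; have Ke v := @path_escaping x v xL.
rewrite enclosed_escaping //.
suff -> : [set u in path x | (u \in strip) && (row e < row u)] = set0 by rewrite cards0.
apply/setP => u; rewrite [LHS]in_set in_set0; apply/negP => /and3P[uK uS _].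
by case: (path_line xL uK (strip_fix uS)) => E; move: uS; rewrite E; apply/negP/line_strip.
Qed.

Lemma enclosed_escaping_strip x e : x \in line -> pt x \in strip -> e \in escaping ->
  enclosed (path x) (dist e) (row e) = (row e < row (pt x)).
Proof.
move=> xL pS eE; have Kq v := path_q v xL; have Km v := path_m v xL; have Ke v := @path_escaping x v xL.
rewrite enclosed_escaping //.
case: (boolP (row e < row (pt x))) => H.
  suff -> : [set u in path x | (u \in strip) && (row e < row u)] = [set pt x] by rewrite cards1.
  apply/setP => u; rewrite [LHS]in_set in_set1; apply/and3P/eqP => [[uK uS _]|->].
    case: (path_line xL uK (strip_fix uS)) => // E.
    by move: (line_strip xL); rewrite -E uS.
  by split=> //; apply: pt_path.
suff -> : [set u in path x | (u \in strip) && (row e < row u)] = set0 by rewrite cards0.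
apply/setP => u; rewrite [LHS]in_set in_set0; apply/negP => /and3P[uK uS us].
case: (path_line xL uK (strip_fix uS)) => E.
  by move: (line_strip xL); rewrite -E uS.
by move: H; rewrite -E us.
Qed.

Lemma line_row u v : u \in line -> v \in line -> row u = row v -> u = v.
Proof. by rewrite !lineE => /eqP E1 /eqP E2 Er; apply: tri_inj; rewrite // E1 E2. Qed.

Lemma notin_path_line x z : x \in line -> z \in line -> z != x -> z != pt x ->
  z \notin path x.
Proof.
move=> xL zL zx zp; apply/negP => /(path_line xL) /(_ (line_fix zL)) [] E.
  by move: zx; rewrite E eqxx.
by move: zp; rewrite E eqxx.
Qed.

Lemma pt_dist0 z : z \in line -> pt z \in line -> dist (pt z) = 0.
Proof. by move=> zL pL; apply/eqP; rewrite -dist_line. Qed.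

(** * Parity of the position of a path end on l' *)

Definition above (x : Q) : nat := #|[set z in line | row x < row z]|.

(** The points of l' strictly between [x] and [pt x] are enclosed by their path, hence joined among
    themselves and even in number; [x] itself accounts for the change of parity. *)
Lemma odd_above_pt x : x \in line -> m x \notin line -> pt x \in line ->
  odd (above (pt x)) = ~~ odd (above x).
Proof.
move=> xL mxL pL.
wlog lt : x xL mxL pL / row (pt x) < row x.
  move=> H; case: (ltgtP (row (pt x)) (row x)) => [lt|gt|eq]; first exact: H.
    by have := H (pt x) pL (pt_match xL mxL pL); rewrite ptK // => /(_ xL gt) ->; rewrite negbK.
  by have := pt_neq xL; rewrite (line_row pL xL eq) eqxx.
pose Z := [set z in line | row (pt x) < row z < row x].
have ZP z : z \in Z -> [/\ z \in line, row (pt x) < row z & row z < row x].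
  by rewrite in_set => /andP[-> /andP[-> ->]].
have Zpath z : z \in Z -> z \notin path x.
  case/ZP=> zL z1 z2; apply: notin_path_line => //; apply/eqP => E.
    by move: z2; rewrite E ltxx.
  by move: z1; rewrite E ltxx.
have evenZ : ~~ odd #|Z|.
  apply: (even_card_involution (f := pt)) => z zZ; have [zL z1 z2] := ZP z zZ; last 2 first.
  - exact: ptK.
  - exact: pt_neq.
  have [pK] := enclosed_pt xL zL (Zpath z zZ).
  rewrite enclosed_line_line // z2 (ltNge (row z)) (ltW z1) /= => pE.
  have pzL : pt z \in line.
    rewrite pt_line_strip //; apply/negP => pS.
    by move: pE; rewrite enclosed_escaping_line // pt_escaping.
  move: pE; rewrite pt_dist0 // enclosed_line_line // => pE.
  have n1 : row (pt z) <> row (pt x).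
    by move=> E; move: pK; rewrite (line_row pzL pL E) pt_path.
  by rewrite in_set pzL; lia.
have -> : above (pt x) = (above x + 1 + #|Z|)%N.
  pose A := [set z in line | row (pt x) < row z]; pose B := [set z | row x <= row z].
  have AE z : (z \in A) = (z \in line) && (row (pt x) < row z) by rewrite in_set.
  have BE z : (z \in B) = (row x <= row z) by rewrite in_set.
  rewrite /above -(cardsID B A); congr (_ + _)%N; last first.
    apply: eq_card => z; rewrite in_setD AE BE [RHS]in_set.
    by case: (z \in line) => //=; lia.
  rewrite -(cardsID [set x] (A :&: B)) [LHS]addnC; congr (_ + _)%N.
    apply: eq_card => z; rewrite in_setD in_setI AE BE [RHS]in_set in_set1.
    case: (boolP (z \in line)) => zL; rewrite ?andbF //=.
    have [-> | zx] := eqVneq z x; first by rewrite ltxx.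
    have : row z <> row x by move=> /(line_row zL xL) E; move: zx; rewrite E eqxx.
    by lia.
  rewrite -(cards1 x); apply: eq_card => z; rewrite 2!in_setI AE BE in_set1.
  by have [-> | zx] := eqVneq z x; rewrite ?andbF // xL lexx lt.
by rewrite !oddD (negbTE evenZ) addbF addbT.
Qed.

(** These paths correspond to the escaping triangles whose partner is on l'. The other escaping
    triangles are paired by [pt], and there is an even number of escaping triangles, at most two. *)
Lemma card_escape_line :
  let n := #|[set x in line | pt x \in strip]| in (n == 0%N) || (n == 2%N).
Proof.
move=> /=; set n := #|_|.
pose E' := [set e in escaping | pt e \in line].
have eS e : e \in escaping -> e \in strip by rewrite escapingE => /andP[].
have efix e : e \in escaping -> q e = e by move/eS/strip_fix.
have nE : n = #|E'|.
  have inj : {in [set x in line | pt x \in strip] &, injective pt}.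
    move=> x y; rewrite in_set [y \in _]in_set => /andP[xL _] /andP[yL _] E.
    by rewrite -(ptK xL) E ptK.
  rewrite /n -(card_in_imset inj); apply: eq_card => e; rewrite [RHS]in_set.
  apply/imsetP/andP => [[x]|[eE peL]].
    by rewrite in_set => /andP[xL pS] ->; rewrite ptK // xL pt_escaping.
  exists (pt e); last by rewrite (partnerK qK mK mN (efix _ eE)).
  by rewrite in_set peL (partnerK qK mK mN (efix _ eE)) eS.
have even' : ~~ odd #|escaping :\: E'|.
  apply: (even_card_involution (f := pt)) => e; rewrite in_setD [e \in E']in_set => /andP[e' eE].
  - have pS : pt e \in strip.
      move: e'; rewrite eE /= fix_line_strip ?negbK //.
      by apply: (partner_fix qK mK mN); apply: efix.
    have peE : pt e \in escaping.
      rewrite escapingE pS; apply/negP => mS.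
      have E := partner_fixed_edge qK mK mN (strip_fix pS) (strip_fix mS).
      move: E; rewrite (partnerK qK mK mN (efix _ eE)) => E.
      by move: eE; rewrite escapingE E mK pS andbF.
    rewrite in_setD peE andbT in_set peE /= (partnerK qK mK mN (efix _ eE)).
    by apply/negP => /line_strip; rewrite eS.
  - by apply: (partnerK qK mK mN); apply: efix.
  - by apply: (partner_neq qK mK mN); apply: efix.
have sub : E' \subset escaping by apply/subsetP => e; rewrite in_set => /andP[].
have := card_escaping; have := even_escaping.
rewrite -(cardsID E' escaping) (setIidPr sub) oddD (negbTE even') addbF -nE.
by case: (n) => [|[|[|k]]] //; lia.
Qed.

(** Partners on l' are exchanged; the points left over start the 0 or 2 paths to the strip. *)
Lemma even_line : ~~ odd #|line|.
Proof.
pose f z := if pt z \in line then pt z else z.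
have fL : {in line, forall z, f z \in line}.
  by move=> z zL; rewrite /f; case: ifP.
have fK : {in line, forall z, f (f z) = z}.
  by move=> z zL; rewrite /f; case: (boolP (pt z \in line)) => pL; rewrite ?ptK ?zL ?(negbTE pL).
rewrite (odd_card_involution fL fK).
suff -> : [set x in line | f x == x] = [set x in line | pt x \in strip].
  by have := card_escape_line => /= /orP[] /eqP ->.
apply/setP => z; rewrite [LHS]in_set [RHS]in_set; case: (boolP (z \in line)) => //= zL.
rewrite /f pt_line_strip //; case: (pt z \in strip); rewrite ?eqxx //=.
by apply/negbTE/pt_neq.
Qed.

(** If the path ends in the upper half of the strip, any other escaping triangle is below its end,
    so the points of l' above [x] are joined among themselves. If it ends in the lower half, this
    holds for the points below [x], and the total number on l' is even. *)
Lemma odd_above_escape x : x \in line -> pt x \in strip ->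
  odd (above x) = up (val (pt x)).
Proof.
move=> xL pS; have pE := pt_escaping xL pS; rewrite (escaping_up pE).
have out z : z \in line -> z != x -> z \notin path x.
  move=> zL zx; apply: notin_path_line => //; apply: contraTneq pS => <-.
  exact: line_strip.
have stable z : z \in line -> z != x ->
    (if row (pt x) < T - b then row z < row x else row x < row z) ->
  pt z \in line /\ (row (pt z) < row x) = (row z < row x).
  move=> zL zx hz; have [pK] := enclosed_pt xL zL (out z zL zx).
  rewrite enclosed_line_strip // => eq_pz.
  suff pzL : pt z \in line.
    by split=> //; move: eq_pz; rewrite pt_dist0 // enclosed_line_strip.
  rewrite pt_line_strip //; apply/negP => pzS.
  have pzE := pt_escaping zL pzS.
  have ne : pt x != pt z by apply: contraNneq pK => <-; apply: pt_path.
  move: eq_pz; rewrite enclosed_escaping_strip //.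
  case: ifP hz => hr hz.
    by rewrite hz ltNge (ltW (lt_le_trans hr (escaping_above pE pzE ne hr))).
  have hr' : T - b <= row (pt x) by rewrite leNgt hr.
  by rewrite (lt_le_trans (escaping_below pE pzE ne hr') hr') (ltNge (row z)) (ltW hz).
have neq z : z \in line -> z != x -> row z <> row x.
  by move=> zL zx /(line_row zL xL) E; move: zx; rewrite E eqxx.
have pz_neq z : z \in line -> pt z \in line -> pt z != x.
  move=> zL pzL; apply: contraTneq pS => E.
  by rewrite -E ptK // line_strip.
case: (boolP (row (pt x) < T - b)) => hr; last first.
  apply/negbTE; apply: (even_card_involution (f := pt)) => z; rewrite in_set => /andP[zL hz].
  - have zx : z != x by apply: contraTneq hz => ->; rewrite ltxx.
    have [|pL E] := stable z zL zx; first by rewrite (negbTE hr).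
    by rewrite in_set pL; have := neq _ pL (pz_neq z zL pL); lia.
  - exact: ptK.
  - exact: pt_neq.
pose Z := [set z in line | row z < row x].
have evenZ : ~~ odd #|Z|.
  apply: (even_card_involution (f := pt)) => z; rewrite in_set => /andP[zL hz].
  - have zx : z != x by apply: contraTneq hz => ->; rewrite ltxx.
    have [|pL E] := stable z zL zx; first by rewrite hr.
    by rewrite in_set pL E.
  - exact: ptK.
  - exact: pt_neq.
have cL : #|line| = (above x + (1 + #|Z|))%N.
  pose B := [set z | row x < row z].
  have BE z : (z \in B) = (row x < row z) by rewrite in_set.
  rewrite -(cardsID B line); congr (_ + _)%N.
    by apply: eq_card => z; rewrite in_setI BE [RHS]in_set.
  rewrite -(cardsID [set x] (line :\: B)); congr (_ + _)%N.
    rewrite -(cards1 x); apply: eq_card => z; rewrite in_setI in_setD in_set1 BE.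
    by have [-> | zx] := eqVneq z x; rewrite ?andbF // xL ltxx.
  apply: eq_card => z; rewrite 2!in_setD in_set1 BE [RHS]in_set.
  case: (boolP (z \in line)) => zL; rewrite ?andbF //= andbT.
  have [-> | zx] := eqVneq z x; first by rewrite ltxx.
  by have := neq z zL zx; lia.
have := even_line; rewrite cL !oddD (negbTE evenZ) addbF addbT.
by rewrite negbK.
Qed.

(** * The bit of a triangle on l' and its behaviour along paths *)

Definition twist (x : Q) : bool := up (val x) (+) odd (above x).

Local Notation Tau := (tau on_right twist m).

Lemma match_side v : v \notin line -> m v \notin line -> on_right (m v) = on_right v.
Proof.
rewrite !lineE /on_right /right_of -/(tri_col v) -/(tri_col (m v)).
by case: (matchP v); lia.
Qed.

(** Side plus orientation is invariant along the walk: [m] reverses the orientation and keeps the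
    side, [q] does the opposite. On l' there is no side, and that of the mate is used. *)
Lemma walk_side x : x \in line -> m x \notin line ->
  exists v, [/\ pt x = m v, (v \notin line) || (m v \notin line)
   & (if v \in line then on_right (m v) else on_right v) (+) up (val v) =
     on_right (m x) (+) up (val x)].
Proof.
move=> xL mxL.
pose P v := ((v \notin line) || (m v \notin line)) &&
   ((if v \in line then on_right (m v) else on_right v) (+) up (val v) ==
     on_right (m x) (+) up (val x)).
have [|v /andP[vL /eqP H] mv|v vP E] := partner_walk (P := P) qK mK mN (line_fix xL).
- by rewrite /P xL mxL eqxx.
- move: mv; rewrite reflection_fix negb_or => /andP[mvL mvS].
  have qL : q (m v) \notin line.
    by apply: contraNN mvL => ql; rewrite -[m v]qK (line_fix ql).
  rewrite /P (negbTE qL) /= on_right_q // -H.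
  have -> : up (val (q (m v))) = ~~ up (val v).
    by rewrite -match_up val_q (negbTE mvS) up_mirror.
  case: (boolP (v \in line)) => [vL'|vL'].
    by rewrite addbN addNb negbK.
  by rewrite match_side // addbN addNb negbK.
by exists v; move: vP => /andP[? /eqP ?].
Qed.

(** Compared with the invariant of [walk_side], the orientation and the parity of [above] both
    change, and the changes cancel. *)
Lemma tau_pt x : x \in line -> m x \notin line -> pt x \in line -> Tau (pt x) = Tau x.
Proof.
move=> xL mxL pL; have [v [E vL H]] := walk_side xL mxL.
have vL' : v \notin line by move: vL; rewrite -E pL orbF.
have mE : m (pt x) = v by rewrite E mK.
have uE : up (val (pt x)) = ~~ up (val v) by rewrite E match_up.
rewrite /tau /twist mE uE odd_above_pt //.
move: H; rewrite (negbTE vL') => H.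
by move: H; case: (on_right v); case: (on_right (m x)); case: (up (val v)); case: (up (val x)); case: (odd _).
Qed.

(** The strip lies to the left of l', which fixes the side at the end of the walk;
    [odd_above_escape] links the orientation there to the parity of [above]. *)
Lemma tau_escape_line x : x \in line -> pt x \in strip -> Tau x.
Proof.
move=> xL pS; have mxL := escape_match xL pS.
have [v [E vL H]] := walk_side xL mxL.
have uE : up (val (pt x)) = ~~ up (val v) by rewrite E match_up.
have pr : on_right (pt x) = false by apply: strip_left.
have pL : pt x \notin line by rewrite pt_line_strip ?pS.
have side_v : (if v \in line then on_right (m v) else on_right v) = false.
  case: ifP => vl; rewrite -?E //.
  by rewrite -match_side ?vl // -E.
move: H; rewrite /tau /twist side_v odd_above_escape // uE.
by case: (on_right (m x)); case: (up (val v)); case: (up (val x)).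
Qed.

End OneMatching.

Lemma matching_count : (#|Ms|%:R : rat) = 2 ^ ((#|line|./2)%:Z - 1) *
  (\sum_(m in Ms | constant_tau line on_right twist true m) 2 ^- (#|inner line m|./2)
   + \sum_(m in Ms | constant_tau line on_right twist false m) 2 ^- (#|inner line m|./2)).
Proof.
apply: (@flip_count _ q line strip).
- exact: reflectionK.
- exact: reflection_fix.
- exact: line_strip.
- exact: on_right_q.
- by move=> m v mM; apply: matchK.
- by move=> m v mM; apply: match_neq.
- by move=> m U mM; apply: flip_matching.
- by move=> m x mM; apply: tau_pt.
- by move=> m x mM; apply: tau_escape_line.
- by move=> m mM; apply: card_escape_line.
Qed.

End Geometry.

(** * The shape of a symmetric hexagon *)

Lemma natmul_point (v : point) (n : nat) : v *+ n = (v.1 * n%:Z, v.2 * n%:Z).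
Proof.
elim: n => [|n IH]; first by rewrite mulr0n !mulr0.
by rewrite mulrS IH; case: v {IH} => x y; congr (_, _) => /=; rewrite -?mulrS; lia.
Qed.

Section HexagonShape.

Variables (h : hexagon) (H : {fset tri}) (l : int).
Hypothesis hex : lattice_hexagon h.
Hypothesis hH : is_region_of h H.
Hypothesis symH : symmetric_about l H.

Let x0 := (hNW h).1.
Let T := (hNW h).2.
Let a := (sideN h)%:Z.
Let b := (sideNE h)%:Z.
Let c := (sideSE h)%:Z.
Let f := (sideNW h)%:Z.

Let closure : [/\ 0 < a, 0 < b, 0 < c, 0 < f & 0 < (sideS h)%:Z /\
  [/\ 0 < (sideSW h)%:Z, (2 %| x0 + T)%Z, (sideSW h)%:Z + f = b + c
  & (sideS h)%:Z + c = a + f]].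
Proof.
case: hex => par pos cl; rewrite /a /b /c /f.
case/and5P: pos => ? ? ? ? /andP[? ?].
move: cl; rewrite !natmul_point /vE /vSE /vSW /vW /vNW /vNE => -[] /=.
by move: par; rewrite /lattice_point -/x0 -/T => ? e1 e2; split; try lia; split; try lia; split; lia.
Qed.

Let boundsE (p : point) : in_hexagon h p =
  [&& T - b - c <= p.2, p.2 <= T, x0 + T - 2 * f <= p.1 + p.2,
      p.1 + p.2 <= x0 + T + 2 * a, x0 - T <= p.1 - p.2
    & p.1 - p.2 <= x0 - T + 2 * a + 2 * b].
Proof.
case: closure => ? ? ? ? [? [? ? ? ?]].
rewrite /in_hexagon /hE /hSE /hW /hSW /hSE /hE /hNE !natmul_point /vE /vSE /vSW /vW /vNW /=.
rewrite -/x0 -/T -/a -/b -/c; lia.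
Qed.

(** Parity of the coordinates of lattice points turns the bounds on the corners into bounds on the
    pair itself that serve both orientations. *)
Let inHE (t : tri) : (t \in H) = [&& T - b - c <= t.2, t.2 < T,
  x0 + T - 2 * f <= t.1 + t.2, t.1 + t.2 < x0 + T + 2 * a,
  x0 - T < t.1 - t.2 & t.1 - t.2 <= x0 - T + 2 * a + 2 * b].
Proof.
case: closure => _ _ _ _ [_ [_ par _ _]].
rewrite hH; case: t => k s; rewrite /corners.
by case E: (up (k, s)); move: E; rewrite /up /= !boundsE /=; lia.
Qed.

Let mirrorH t : t \in H -> mirror l t \in H.
Proof. by move=> tH; rewrite -symH; apply/imfsetP; exists t. Qed.

Let lE : l = x0 + a.
Proof.
case: closure => ? ? ? ? [? [? ? ? ?]].
(* The two end triangles of the northernmost row bound the axis from both sides. *)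
have /mirrorH : ((x0, T - 1) : tri) \in H by rewrite inHE /=; lia.
have /mirrorH : ((x0 + 2 * a, T - 1) : tri) \in H by rewrite inHE /=; lia.
by rewrite !inHE /mirror /=; lia.
Qed.

Let fE : f = b.
Proof.
case: closure => ? ? ? ? [? [? ? ? ?]].
have [lt|[gt|//]] : b < f \/ (f < b \/ f = b) by lia.
  (* The leftmost triangle of the row just below the eastern corner, where the hexagon still widens
     on the left only. The other case uses the rightmost triangle just below the western corner. *)
  have /mirrorH : ((x0 - b, T - 1 - b) : tri) \in H by rewrite inHE /=; lia.
  by rewrite inHE /mirror /= lE; lia.
have /mirrorH : ((x0 + 2 * a + f, T - 1 - f) : tri) \in H by rewrite inHE /=; lia.
by rewrite inHE /mirror /= lE; lia.
Qed.

Lemma hexagon_shape : [/\ 0 < a, 0 < b, 0 < c, 0 < a + b - c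
  & (2 %| l - a + T)%Z /\ forall t, (t \in H) = in_hex l T a b c t].
Proof.
case: closure => ? ? ? ? [? [? ? ? ?]]; split=> //; first by rewrite -fE; lia.
split; first by rewrite lE; lia.
by move=> t; rewrite inHE /in_hex fE lE; lia.
Qed.

(** At lattice points [x - y] has a fixed parity, so a corner off the southeastern side misses the
    maximum by at least 2, the amount gained in a shift by [vSE]. *)
Lemma touches_SE_bound t : t \in H -> ~~ touches_SE h t ->
  t.1 - l <= a + 2 * b - T + t.2 - 2.
Proof.
case: closure => ? ? ? ? [? [? par ? ?]].
rewrite hH /touches_SE => /allP tH /hasPn tN.
have far p : p \in corners t -> p.1 - p.2 != x0 - T + 2 * a + 2 * b.
  move=> pt; have := tN p pt; rewrite /on_SE_side tH //=.
  rewrite /hE /hNE !natmul_point /vE /vSE /= -/x0 -/T -/a -/b.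
  apply: contraNneq => ->; apply/eqP; lia.
have bnd p : p \in corners t -> p.1 - p.2 <= x0 - T + 2 * a + 2 * b.
  by move/tH; rewrite boundsE => /and5P[_ _ _ _ /andP[]].
move: far bnd; case: t {tH tN} => k s; rewrite /corners; case E: (up (k, s)); move: E; rewrite /up /=.
  move=> E /(_ (k + 1, s)) + /(_ (k + 1, s)); rewrite !inE eqxx orbT => /(_ isT) /= + /(_ isT) /=.
  by rewrite lE; lia.
move=> E /(_ (k, s)) + /(_ (k, s)); rewrite !inE eqxx !orbT => /(_ isT) /= + /(_ isT) /=.
by rewrite lE; lia.
Qed.

End HexagonShape.

(** * Matchings of the cut graphs as matchings with a constant bit *)

Section CutGraph.

Variables (l : int) (Q : {fset tri}).

Local Notation n := (l + 1).
Local Notation L := (line l Q).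
Local Notation col := (@tri_col Q).
Local Notation row := (@tri_row Q).

Let in_line (v : Q) : (v \in L) = (col v == n). Proof. by rewrite inE. Qed.

Let crossed_list_perm : perm_eq (crossed_list n Q) [seq val v | v <- enum L].
Proof.
rewrite /crossed_list perm_sort; apply: uniq_perm.
- by rewrite filter_uniq ?fset_uniq.
- by rewrite map_inj_uniq ?enum_uniq //; apply: val_inj.
move=> t; rewrite mem_filter; apply/andP/mapP => [[tn tQ]|[v + ->]].
  by exists [` tQ]; rewrite // mem_enum inE.
by rewrite mem_enum inE => vL; split=> //; apply: valP.
Qed.

Lemma width_line : width n Q = #|L|./2.
Proof. by rewrite /width (perm_size crossed_list_perm) size_map -cardE. Qed.

(** In the list sorted from top to bottom the predecessors of a triangle are those in higher rows,
    since on l' the row determines the triangle. *)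
Lemma index_crossed_list v : v \in L -> index (val v) (crossed_list n Q) = above l v.
Proof.
move=> vL.
have -> : above l v = count (fun t : tri => (val v).2 < t.2) (crossed_list n Q).
  rewrite (seq.permP crossed_list_perm) count_map -size_filter /above cardE.
  apply: perm_size; apply: uniq_perm; first exact: enum_uniq.
    exact/filter_uniq/enum_uniq.
  by move=> z; rewrite mem_enum in_set mem_filter mem_enum andbC.
have : val v \in crossed_list n Q.
  by rewrite (perm_mem crossed_list_perm) map_f // mem_enum.
have : all (fun t : tri => t.1 == n) (crossed_list n Q).
  rewrite (perm_all _ crossed_list_perm); apply/allP => _ /mapP[u + ->].
  by rewrite mem_enum in_line.
have : sorted (fun t u : tri => u.2 <= t.2) (crossed_list n Q).
  by apply: sort_sorted => t u; apply: le_total.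
have : (val v).1 == n by rewrite -in_line.
elim: (crossed_list n Q) (val v) => // u s IH t /eqP tn; rewrite /= path_sortedE; last first.
  by move=> ? ? ? h1 h2; apply: le_trans h2 h1.
case/andP=> /allP us ss /andP[/eqP un sn]; rewrite in_cons.
have [-> _ | tu /= ts] := eqVneq t u; rewrite ?eqxx.
  rewrite ltxx; symmetry; apply/eqP; rewrite -leqn0 leqNgt -has_count -all_predC.
  by apply/allP => z /us /=; rewrite leNgt.
rewrite IH //; last exact/eqP.
suff -> : t.2 < u.2 by [].
rewrite lt_neqAle us // andbT; apply: contraNneq tu => E.
by rewrite [t]surjective_pairing [u]surjective_pairing tn un E.
Qed.

Lemma above_step u v : u \in L -> v \in L -> row v = row u + 1 ->
  above l u = (above l v).+1.
Proof.
move=> uL vL E; have uv : row u < row v by rewrite E; lia.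
rewrite /above (cardsD1 v) in_set vL uv add1n; congr S; apply: eq_card => z; rewrite in_setD1 2!in_set.
case: (boolP (z \in L)) => zL; rewrite ?andbF //=.
have [-> | zv] := eqVneq z v; first by rewrite ltxx.
have : row z <> row v.
  move: zL vL; rewrite !in_line => /eqP zc /eqP vc E2; move: zv => /eqP; apply.
  by apply: tri_inj; rewrite // zc vc.
by rewrite E; lia.
Qed.

Variable w : bool.

Let top := up (head (0, 0) (crossed_list n Q)).

Lemma cut_on_rightE v : v \in L ->
  cut_on_right n Q w (val v) = twist l v (+) (top (+) w).
Proof.
move=> vL; rewrite /cut_on_right /white /is_a index_crossed_list // -/top /twist.
by case: (up _); case: top; case: (odd _); case: w.
Qed.

(** Between neighbours on l' the orientation and the parity of [above] both change, so [twist] does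
    not. *)
Let adj_line (u v : Q) : u \in L -> v \in L -> adjacent (val u) (val v) ->
  cut_on_right n Q w (val u) = cut_on_right n Q w (val v).
Proof.
move=> uL vL uv; rewrite !cut_on_rightE // /twist (adjacent_up uv).
have : row v = row u + 1 \/ row u = row v + 1.
  by move: uL vL uv; rewrite !in_line adjacentE !valE /=; lia.
case=> E; first by rewrite (above_step uL vL E) /=; case: (up _); case: (odd _); case: top.
by rewrite (above_step vL uL E) /=; case: (up _); case: (odd _); case: top.
Qed.

Lemma cut_adjacent_sym : symmetric (cut_adjacent n Q w).
Proof. by move=> t u; rewrite /cut_adjacent adjacent_sym [X in _ && X]andbC. Qed.

(** No remaining edge joins the two parts: those within l' are covered by [adj_line], those leaving
    l' by the deletions. *)
Lemma M_parts : M (plus_part n Q w) * M (minus_part n Q w) = M (cut_graph n Q w).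
Proof.
rewrite /plus_part /minus_part -M_disjoint //.
- apply/fsetP => t; rewrite !inE /= /right_of /left_of /crossed.
  case: (t \in Q) => //=; case: (ltgtP t.1 n) => //=.
  by case: cut_on_right.
- apply/fdisjointP => t; rewrite !inE /= /right_of /left_of /crossed => /andP[-> /=].
  by case: (ltgtP t.1 n) => //= _; case: cut_on_right.
move=> B /imfset2P[t tQ [u]]; rewrite !inE /= => /andP[uQ /and3P[tu dt du]] ->.
apply/andP; split; first by apply/fset0Pn; exists t; rewrite fset21.
have H : (t \in [fset t in Q | right_of n t || crossed n t && ~~ cut_on_right n Q w t]) =
     (u \in [fset t in Q | right_of n t || crossed n t && ~~ cut_on_right n Q w t]).
  rewrite !inE /= tQ uQ /=.
  have [tn | tn] := eqVneq t.1 n; have [un | un] := eqVneq u.1 n.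
  - have := @adj_line [` tQ] [` uQ]; rewrite !in_line /tri_col /= tn un eqxx => /(_ isT isT tu) ->.
    by rewrite /right_of /crossed tn un.
  - move: dt; rewrite /deleted_at /right_of /left_of /crossed tn eqxx (negbTE un) ltxx /=.
    case: cut_on_right => /=; rewrite ?orbF; last by move: un; case: ltgtP.
    by move/negbTE->.
  - move: du; rewrite /deleted_at /right_of /left_of /crossed un eqxx (negbTE tn) ltxx /=.
    case: cut_on_right => /=; rewrite ?orbF; last by move: tn; case: ltgtP.
    by move/negbTE->.
  rewrite /right_of /crossed (negbTE tn) (negbTE un) /= !orbF.
  by move: tu tn un; rewrite adjacentE; case: (t) (u) => [k s] [k' s'] /=; lia.
have C x : x \in Q -> (x \in [fset t in Q | left_of n t || crossed n t && cut_on_right n Q w t]) =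
    (x \notin [fset t in Q | right_of n t || crossed n t && ~~ cut_on_right n Q w t]).
  move=> xQ; rewrite !inE /= xQ /= /right_of /left_of /crossed.
  by case: (ltgtP x.1 n) => //= _; rewrite negbK.
case: (boolP (t \in [fset t in Q | right_of n t || crossed n t && ~~ cut_on_right n Q w t])) => tS.
  by apply/orP; left; apply/fsubsetP => x /fset2P[] ->; rewrite // -H.
by apply/orP; right; apply/fsubsetP => x /fset2P[] ->; rewrite C // -H.
Qed.

Local Notation Ms := (@matchings _ Q adjacent).

(** A triangle on l' matched off l' must have its mate on the side that is not cut, and by
    [cut_on_rightE] this prescribes its bit, the same for all. *)
Lemma matchings_cut :
  matchings Q (cut_adjacent n Q w) =
  [set m in Ms | constant_tau L (on_right l (Q := Q)) (twist l (Q := Q)) (~~ (top (+) w)) m].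
Proof.
apply/setP => m; rewrite in_set; apply/idP/andP.
  case/matchingsP=> me mK; have mM : m \in Ms.
    by apply/matchingsP; split=> // v; case/and3P: (me v).
  split=> //; apply/forall_inP => x xL; apply/implyP => mxL.
  case/and3P: (me x) => _ + _; rewrite /deleted_at cut_on_rightE //.
  move: (xL) (mxL); rewrite in_line /crossed -/(col x) => -> /=.
  rewrite in_line /tau /on_right /right_of /left_of -/(col (m x)).
  by case: (ltgtP (col (m x)) n) => //= _ _; case: (twist l x); case: (top (+) w).
case=> mM /forall_inP H; have /matchingsP[me mK] := mM.
have del x : ~~ deleted_at n Q w (val x) (val (m x)).
  rewrite /deleted_at; case: (boolP (crossed n (val x))) => //= xc.
  have xL : x \in L by rewrite inE.
  have := H x xL; rewrite cut_on_rightE // in_line /tau /on_right /right_of /left_of -/(col (m x)).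
  by case: (ltgtP (col (m x)) n) => //= _; case: (twist l x); case: (top (+) w).
apply/matchingsP; split=> // v; rewrite /cut_adjacent me del /=.
by rewrite -{2}(mK v) del.
Qed.

(** Edges inside l' have weight 1/2, and each is counted at its up-pointing end, hence for half of
    the points of [inner]. *)
Lemma prod_cut_weight m : m \in Ms ->
  \prod_(v : Q | up (val v)) cut_weight n (pair_of m v) = 2 ^- (#|inner L m|./2).
Proof.
move=> mM; have /matchingsP[me mK] := mM.
have wE v : cut_weight n (pair_of m v) = if v \in inner L m then 2^-1 else 1.
  rewrite /cut_weight; have -> : all (crossed n) (enum_fset (pair_of m v)) = (v \in inner L m).
    rewrite in_set !inE; apply/allP/andP => [H|[H1 H2] t].
      by split; apply: H; rewrite ?fset21 ?fset22.
    by case/fset2P=> ->.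
  by [].
rewrite (eq_bigr _ (fun v _ => wE v)) -big_mkcondr prodr_const exprVn; congr (_ ^- _).
set U := #|_|.
have -> : #|inner L m| = (U + U)%N.
  rewrite -(cardsID [set v | up (val v)] (inner L m)); congr (_ + _)%N.
    by apply: eq_card => v; rewrite in_setI [v \in [set _ | _]]in_set andbC.
  rewrite -[RHS](card_imset _ (@perm_inj _ m)); apply: eq_card => v.
  rewrite in_setD [v \in [set _ | _]]in_set.
  have stab u : u \in inner L m -> m u \in inner L m.
    by rewrite !(in_set (fun _ => _)) mK => /andP[-> ->].
  apply/andP/imsetP => [[uv vI]|[u + ->]].
    exists (m v); last by rewrite mK.
    by rewrite unfold_in /= stab // (adjacent_up (me v)) uv.
  rewrite unfold_in /= => /andP[uu uI]; split; last exact: stab.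
  by rewrite (adjacent_up (me u)) uu.
by rewrite addnn doubleK.
Qed.

Lemma M_cut_graph : M (cut_graph n Q w) =
  \sum_(m in Ms | constant_tau L (on_right l (Q := Q)) (twist l (Q := Q)) (~~ (top (+) w)) m)
     2 ^- (#|inner L m|./2).
Proof.
rewrite /cut_graph (M_sum_matchings _ _ (col := up) cut_adjacent_sym); last first.
  by move=> t u /and3P[tu _ _]; apply: adjacent_up.
rewrite matchings_cut; apply: eq_big => m; first by rewrite in_set.
by rewrite in_set => /andP[mM _]; apply: prod_cut_weight.
Qed.

End CutGraph.

(** * Assembling the count *)

Lemma M_dual_graph (Q : {fset tri}) : M (dual_graph Q) = #|@matchings _ Q adjacent|%:R.
Proof.
rewrite /dual_graph (M_sum_matchings _ _ (col := up) adjacent_sym adjacent_up).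
rewrite -sum1_card natr_sum; apply: eq_bigr => m _.
by rewrite big1.
Qed.

(** This makes the set of removed triangles symmetric about l'. *)
Lemma shiftSE_mirror (l : int) (t : tri) :
  mirror (l + 1) (shiftSE t) = shiftSE (mirror l t).
Proof. by case: t => k s; rewrite /mirror /shiftSE /=; congr (_, _); lia. Qed.

Theorem theorem2p2 (h : hexagon) (H C : {fset tri}) (l : int)
    (hex : lattice_hexagon h)
    (hH : is_region_of h H)
    (symH : symmetric_about l H)
    (CH : C `<=` H)
    (symC : symmetric_about l C)
    (noS : forall t : tri, t \in C -> ~~ touches_S h t)
    (noSE : forall t : tri, t \in C -> ~~ touches_SE h t) :
  let R0 := H `\` C in
  let R := H `\` [fset shiftSE t | t in C] in
  let l' := l + 1 in
  (exists T : {fset {fset tri}}, perfect_matching (dual_graph R0) T) ->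
  M (dual_graph R) =
    2 ^ ((width l' R)%:Z - 1)
    * (M (plus_part l' R true) * M (minus_part l' R true)
       + M (plus_part l' R false) * M (minus_part l' R false)).
Proof.
move=> R0 R l' _; rewrite {}/l' {R0}.
have [a0 b0 c0 d0 [par HE]] := hexagon_shape hex hH symH.
have mirrorC t : t \in C -> mirror l t \in C.
  by move=> tC; rewrite -symC; apply/imfsetP; exists t.
have mirrorK t : mirror (l + 1) (mirror (l + 1) t) = t.
  by case: t => k s; rewrite /mirror /=; congr (_, _); lia.
have mirrorS t : t \in [fset shiftSE t | t in C] ->
    mirror (l + 1) t \in [fset shiftSE t | t in C].
  case/imfsetP=> u /= uC ->; rewrite shiftSE_mirror; apply/imfsetP.
  by exists (mirror l u) => //=; apply: mirrorC.
have R_hex t : t \in R -> in_hex l (hNW h).2 (sideN h) (sideNE h) (sideSE h) t.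
  by rewrite inE -HE => /andP[].
have R_mirror t : t \in R ->
    in_hex l (hNW h).2 (sideN h) (sideNE h) (sideSE h) (mirror (l + 1) t) ->
    mirror (l + 1) t \in R.
  rewrite !in_fsetD -HE => /andP[tS _] ->; rewrite andbT.
  by apply: contraNN tS => /mirrorS; rewrite mirrorK.
have R_strip t : in_hex l (hNW h).2 (sideN h) (sideNE h) (sideSE h) t ->
    ~~ in_hex l (hNW h).2 (sideN h) (sideNE h) (sideSE h) (mirror (l + 1) t) -> t \in R.
  move=> th tm; rewrite in_fsetD HE th andbT; apply: contraNN tm.
  case/imfsetP=> u /= uC tE; rewrite tE shiftSE_mirror.
  (* A removed triangle is not in the strip: its image in l' is the shift of [mirror l u], which
     stays in the hexagon because [mirror l u] does not touch the southeastern side. *)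
  have vC := mirrorC u uC.
  have vH := fsubsetP CH _ vC.
  have := touches_SE_bound hex hH symH vH (noSE _ vC).
  move: vH th; rewrite HE tE /in_hex /shiftSE /mirror.
  by case: (u) => k s /=; lia.
rewrite M_dual_graph width_line (matching_count a0 b0 c0 d0 par R_hex R_mirror R_strip).
rewrite !M_parts !M_cut_graph; congr (_ * _).
(* The orientation of the topmost triangle on l' decides which coloring gives which constant bit;
   the sum is symmetric in the two. *)
by case: (up _) => /=; rewrite // addrC.
Qed.
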